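(* There exists a function $C:[0,\infty)\to(0,\infty)$ such that the following holds. Let $B_r\subset\mathbb{R}^2$ denote the open ball of radius $r$ centered at the origin, and let $u\in C^4(B_1)$ be a bounded coordinate-convex function satisfying $$(u_{11}u_{22})^{1/2}=1\quad\text{in } B_1.$$ Then $$\|u\|_{C^2(B_{1/2})}< C\big(\|u\|_{L^\infty(B_1)}\big).$$
   Context: Subscripts denote partial derivatives: $u_{ij}=\partial_i\partial_j u$. A continuous function on an open set $\Omega\subset\mathbb{R}^2$ is called coordinate-convex if it is convex when restricted to segments contained in $\Omega$ that are parallel to a coordinate axis. For a $C^2$ function this means $u_{11}\ge 0$ and $u_{22}\ge 0$. $\|u\|_{C^2(B_{1/2})}$ is the usual norm: the sum of the suprema over $B_{1/2}$ of $|u|$, $|\nabla u|$ and $|D^2u|$. *)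

(* Defs.v *)
(* Planar functions are curried maps [R -> R -> R] on the Stdlib reals, with
   Coquelicot's partial derivatives and classes C^n; MathComp-Analysis is used
   (through the realType structure of Stdlib's [R]) only for Lebesgue measure. *)
From mathcomp Require Import all_boot all_order all_algebra.
From mathcomp Require Import all_classical all_reals all_analysis.
From mathcomp Require Import Rstruct.
From Stdlib Require Import Reals.
From Coquelicot Require Import Coquelicot.

Local Open Scope R_scope.

Definition ball0 (r : R) (x y : R) : Prop := sqrt (x ^ 2 + y ^ 2) < r.

(* The slices are those in the recursive calls of Coquelicot's [ex_diff_n]. *)
Definition pd1 (u : R -> R -> R) : R -> R -> R :=
  fun x y => Derive (fun t => u t y) x.
Definition pd2 (u : R -> R -> R) : R -> R -> R :=
  fun x y => Derive (fun t => u x t) y.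

Definition of_class_C (n : nat) (Om : R -> R -> Prop) (u : R -> R -> R) : Prop :=
  forall x y, Om x y -> ex_diff_n u n x y.

Definition bounded_on (Om : R -> R -> Prop) (u : R -> R -> R) : Prop :=
  exists M : R, forall x y, Om x y -> Rabs (u x y) <= M.

Definition segment (a b t : R) : R := (1 - t) * a + t * b.

(* Requiring the inequality on every segment contained in [Om], in terms of the
   endpoints of that segment, is convexity of [u] on every such segment. *)
Definition coordinate_convex (Om : R -> R -> Prop) (u : R -> R -> R) : Prop :=
  (forall x y, Om x y -> continuity_2d_pt u x y) /\
  (forall a b y,
     (forall t, 0 <= t <= 1 -> Om (segment a b t) y) ->
     forall t, 0 <= t <= 1 ->
       u (segment a b t) y <= (1 - t) * u a y + t * u b y) /\
  (forall x a b,
     (forall t, 0 <= t <= 1 -> Om x (segment a b t)) ->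
     forall t, 0 <= t <= 1 ->
       u x (segment a b t) <= (1 - t) * u x a + t * u x b).

Definition grad_norm (u : R -> R -> R) (x y : R) : R :=
  sqrt (pd1 u x y ^ 2 + pd2 u x y ^ 2).

Definition hess_norm (u : R -> R -> R) (x y : R) : R :=
  sqrt (pd1 (pd1 u) x y ^ 2 + pd1 (pd2 u) x y ^ 2
        + pd2 (pd1 u) x y ^ 2 + pd2 (pd2 u) x y ^ 2).

Definition sup_on (Om : R -> R -> Prop) (f : R -> R -> R) : Rbar :=
  Lub_Rbar (fun z => exists x y, Om x y /\ z = f x y).

(* Valued in [Rbar], so that a finite upper bound includes finiteness. *)
Definition C2_norm (Om : R -> R -> Prop) (u : R -> R -> R) : Rbar :=
  Rbar_plus (Rbar_plus (sup_on Om (fun x y => Rabs (u x y)))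
                       (sup_on Om (grad_norm u)))
            (sup_on Om (hess_norm u)).

Definition lebesgue_measure2 :=
  product_measure1 (@lebesgue_measure R) (@lebesgue_measure R).

(* The norm of L^oo(Om), computed on the extension of [u] by 0 outside [Om].
   [fine] loses nothing on bounded functions, whose norm is finite. *)
Definition Linf_norm (Om : R -> R -> Prop) (u : R -> R -> R) : R :=
  fine (Lnorm lebesgue_measure2 +oo%E
    (fun p : R * R =>
       EFin (patch (fun=> 0) [set q | Om q.1 q.2]%classic
                   (fun q => u q.1 q.2) p))).

(* Main.v *)
Require Import Defs.
From Stdlib Require Import Reals Lra Lia Psatz ClassicalEpsilon.
From Coquelicot Require Import Coquelicot.
Local Open Scope R_scope.

(** Write [p = u_x], [q = u_y], [A = u_xx], [B = u_yy], [w = u_xy].  Convexity and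
    the equation give [A, B > 0] and [A B = 1], and the linearized operator is
    [L phi = B phi_xx + A phi_yy].  It annihilates [p], [q], [x] and [y], and
    differentiating the equation gives
      [L w = - 2 w_x w_y]    and    [L B = 2 (w_x)^2 B^2].
    Convexity in each variable bounds the gradient by some [M].  The second
    derivatives are then bounded in three steps.

    - Bound of [w] ([mixed_derivative_bound]).  Apply the maximum principle to
      [ln w + al (p + 2 M)^2 + al (q - 2 M)^2 + ln cutoff], with [al] small.  Since
      [L (p^2) = 2 A (1 + w^2)] and [L (q^2) = 2 B (1 + w^2)], the quadratic terms
      dominate the terms produced by the cutoff, except for those of size [w] and
      [w^2].  The added function increases in [p] and decreases in [q]; because of
      these opposite monotonicities, the bad term [- 2 w_x w_y / w] produces a
      positive cubic term in [w], which absorbs the rest.  The same argument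
      with [- w] and [- p] in place of [w] and [p] bounds [w] from below.

    - Lower bound for increments of [p] ([slope_increment_lower_bound]).  Let
      [m y = p (a + r) y - p a y], the integral of [A] over a horizontal segment.
      As [w] is bounded, [m y <= m y0 + 2 W (y - y0)], and the integral of
      [B = 1 / A] over the same segment is at least [r^2 / m y].  Integrating in
      [y] gives a quantity of order [- ln (m y0)], which is at most the oscillation
      of the integral of [q].  So [m y0] cannot be too small.

    - Bound of [B] ([pure_derivative_bound]).  Use the maximum principle for
      [ln B + (x - x0)^2 + ln eta], where the cutoff
      [eta = c^2 - (p - p0)^2 - W^2 (y - y0)^2] is a function of [p] and [y] rather
      than of [x] and [y]; by the preceding step it is nonpositive on the boundary
      of a small rectangle.  In the metric of [L], both [p] and [y] have squared
      gradients comparable to [A], while [L ((x - x0)^2) = 2 B] dominates when [B]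
      is large.
      Exchanging the variables bounds [A].

    Finally, a continuous function is bounded pointwise by its essential supremum,
    so that all constants depend on the norm in [L^oo] only. *)

(** * Calculus in one and two variables *)

Lemma mean_value (f df : R -> R) (a b : R) :
  a <= b -> (forall x, a <= x <= b -> is_derive f x (df x)) ->
  exists c, a <= c <= b /\ f b - f a = df c * (b - a).
Proof.
intros Hab Hd.
destruct (MVT_gen f a b df) as [c Hc].
- rewrite Rmin_left, Rmax_right by lra. intros x Hx; apply Hd; lra.
- rewrite Rmin_left, Rmax_right by lra. intros x Hx.
  apply continuity_pt_filterlim, (ex_derive_continuous f).
  exists (df x); apply Hd; lra.
- rewrite Rmin_left, Rmax_right in Hc by lra. exists c; exact Hc.
Qed.

Lemma second_derivative_test (g g1 : R -> R) (g2 t0 : R) :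
  locally t0 (fun t => is_derive g t (g1 t)) ->
  is_derive g1 t0 g2 ->
  locally t0 (fun t => g t <= g t0) ->
  g1 t0 = 0 /\ g2 <= 0.
Proof.
intros [d1 H1] H2 [d2 H3].
assert (Hb : forall d : posreal, forall t, Rabs (t - t0) < d -> ball t0 d t)
  by (intros d t Ht; exact Ht).
assert (Z : g1 t0 = 0).
{ set (d := Rmin d1 d2).
  assert (Hd : 0 < d) by (apply Rmin_pos; apply cond_pos).
  assert (D0 : derivable_pt_lim g t0 (g1 t0))
    by (apply is_derive_Reals, H1, ball_center).
  set (pr := exist _ _ D0 : derivable_pt g t0).
  change (g1 t0) with (derive_pt g t0 pr).
  apply (deriv_maximum g (t0 - d) (t0 + d) t0 pr); try lra.
  intros t Ha Hc. apply H3, Hb.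
  apply Rlt_le_trans with d; [apply Rabs_def1; lra | apply Rmin_r]. }
split; [exact Z |].
destruct (Rle_or_lt g2 0) as [|Hpos]; [assumption | exfalso].
(* If g2 > 0 then g1 > 0 just to the right of t0, and g exceeds g t0 there. *)
apply is_derive_Reals in H2.
destruct (H2 (g2 / 2)) as [d3 H4]; [lra |].
set (d := Rmin d1 (Rmin d2 d3)).
assert (Hd : 0 < d) by (repeat apply Rmin_pos; apply cond_pos).
assert (L1 : d <= d1) by apply Rmin_l.
assert (L2 : d <= d2) by (eapply Rle_trans; [apply Rmin_r | apply Rmin_l]).
assert (L3 : d <= d3) by (eapply Rle_trans; [apply Rmin_r | apply Rmin_r]).
destruct (mean_value g g1 (t0 + d / 4) (t0 + d / 2)) as [c [Hc E]]; [lra | |].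
{ intros x Hx. apply H1, Hb, Rabs_def1; lra. }
destruct (mean_value g g1 t0 (t0 + d / 4)) as [c' [Hc' E']]; [lra | |].
{ intros x Hx. apply H1, Hb, Rabs_def1; lra. }
assert (Hg : g (t0 + d / 2) <= g t0) by (apply H3, Hb, Rabs_def1; lra).
assert (P : forall x, t0 < x <= t0 + d / 2 -> 0 < g1 x).
{ intros x Hx.
  specialize (H4 (x - t0)).
  replace (t0 + (x - t0)) with x in H4 by ring.
  rewrite Z in H4.
  assert (Q : Rabs ((g1 x - 0) / (x - t0) - g2) < g2 / 2)
    by (apply H4; [lra | apply Rabs_def1; lra]).
  apply Rabs_def2 in Q.
  assert (E2 : g1 x = (g1 x - 0) / (x - t0) * (x - t0)) by (field; lra).
  rewrite E2. apply Rmult_lt_0_compat; lra. }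
assert (Pc := P c ltac:(lra)).
assert (0 <= g1 c').
{ destruct (Req_dec c' t0) as [-> | N]; [lra | apply Rlt_le, P; lra]. }
nra.
Qed.

(** If [F] has a local maximum and equals a positive multiple of [exp o G] near
    the point, then [G] has a local maximum there. *)
Lemma local_max_of_exp (F G : R -> R) (c t0 : R) :
  0 < c ->
  locally t0 (fun t => F t = c * exp (G t)) ->
  locally t0 (fun t => F t <= F t0) ->
  locally t0 (fun t => G t <= G t0).
Proof.
intros Hc HF HM.
assert (H0 := locally_singleton _ _ HF). simpl in H0.
generalize (filter_and _ _ HF HM). apply filter_imp. intros t [E L].
rewrite E, H0 in L. apply Rmult_le_reg_l in L; [| exact Hc].
destruct (Rle_or_lt (G t) (G t0)) as [|K]; [assumption |].
apply exp_increasing in K. lra.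
Qed.

(** The point of [[a, b]] nearest to [x], when [a <= b]. *)
Definition clamp (a b x : R) : R := Rmax a (Rmin b x).

Lemma clamp_in a b x : a <= b -> a <= clamp a b x <= b.
Proof. unfold clamp, Rmax, Rmin; intros; repeat destruct Rle_dec; lra. Qed.

Lemma clamp_id a b x : a <= x <= b -> clamp a b x = x.
Proof. unfold clamp, Rmax, Rmin; intros; repeat destruct Rle_dec; lra. Qed.

Lemma clamp_lipschitz a b x y : Rabs (clamp a b x - clamp a b y) <= Rabs (x - y).
Proof.
assert (H := Rle_abs (x - y)). assert (H' := Rabs_maj2 (x - y)).
apply Rabs_le. unfold clamp, Rmin.
repeat destruct Rle_dec; unfold Rmax; repeat destruct Rle_dec; lra.
Qed.

Lemma rectangle_max (f : R -> R -> R) (a b c d : R) :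
  a <= b -> c <= d ->
  (forall x y, a <= x <= b -> c <= y <= d -> continuity_2d_pt f x y) ->
  exists x0 y0, a <= x0 <= b /\ c <= y0 <= d /\
    forall x y, a <= x <= b -> c <= y <= d -> f x y <= f x0 y0.
Proof.
intros Hab Hcd Hf.
assert (U := uniform_continuity_2d f a b c d Hf).
assert (S : forall y, exists x0, a <= x0 <= b /\
   forall x, a <= x <= b -> f x (clamp c d y) <= f x0 (clamp c d y)).
{ intros y.
  destruct (continuity_ab_maj (fun x => f (clamp a b x) (clamp c d y)) a b Hab)
    as [x0 [Hm Hx0]].
  - intros x Hx eps Heps. destruct (U (mkposreal eps Heps)) as [dl Hd].
    exists dl. split; [apply cond_pos |]. intros t [_ Ht]. simpl in *.
    unfold R_dist in *.
    apply Hd; try (apply clamp_in; assumption).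
    + eapply Rle_lt_trans; [apply clamp_lipschitz | exact Ht].
    + rewrite Rminus_diag_eq, Rabs_R0 by reflexivity. apply cond_pos.
  - exists x0. split; [exact Hx0 |]. intros x Hx.
    generalize (Hm x Hx). now rewrite !(clamp_id a b) by assumption. }
set (X := fun y => proj1_sig (constructive_indefinite_description _ (S y))).
assert (HX : forall y, a <= X y <= b /\
   forall x, a <= x <= b -> f x (clamp c d y) <= f (X y) (clamp c d y))
  by (intros y; exact (proj2_sig (constructive_indefinite_description _ (S y)))).
destruct (continuity_ab_maj (fun y => f (X y) (clamp c d y)) c d Hcd)
  as [y0 [Hm Hy0]].
- intros y Hy eps Heps. destruct (U (mkposreal eps Heps)) as [dl Hd].
  exists dl. split; [apply cond_pos |]. intros t [_ Ht]. simpl in *.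
  unfold R_dist in *.
  assert (Hd' := fun x (Hx : a <= x <= b) => Hd x (clamp c d y) x (clamp c d t) Hx
    (clamp_in c d y Hcd) Hx (clamp_in c d t Hcd)).
  assert (K : forall x, a <= x <= b ->
     Rabs (f x (clamp c d t) - f x (clamp c d y)) < eps).
  { intros x Hx. apply Hd'; auto.
    - rewrite Rminus_diag_eq, Rabs_R0 by reflexivity. apply cond_pos.
    - eapply Rle_lt_trans; [apply clamp_lipschitz | exact Ht]. }
  destruct (HX y) as [Hy1 Hy2]. destruct (HX t) as [Ht1 Ht2].
  assert (K1 := K _ Hy1). assert (K2 := K _ Ht1).
  apply Rabs_def2 in K1. apply Rabs_def2 in K2.
  assert (L1 := Ht2 _ Hy1). assert (L2 := Hy2 _ Ht1).
  apply Rabs_def1; lra.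
- exists (X y0), y0. destruct (HX y0) as [Hy1 Hy2].
  split; [exact Hy1 | split; [exact Hy0 |]]. intros x y Hx Hy.
  generalize (Hm y Hy). rewrite !(clamp_id c d) by assumption. intros L.
  destruct (HX y) as [_ Hy3]. specialize (Hy3 x Hx).
  rewrite clamp_id in Hy3 by assumption. lra.
Qed.

Lemma locally_interior (a b t : R) : a < t < b -> locally t (fun z => a < z < b).
Proof.
intros H. apply (locally_interval _ t (Finite a) (Finite b)); simpl; try apply H.
intros y Hy1 Hy2. split; assumption.
Qed.

Lemma locally_pos (f : R -> R) (t l : R) :
  is_derive f t l -> 0 < f t -> locally t (fun z => 0 < f z).
Proof.
intros Hd Hp.
assert (C : continuous f t) by (apply (ex_derive_continuous f); now exists l).
apply (C (fun z => 0 < z)).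
apply (locally_interval _ (f t) (Finite 0) p_infty); simpl; auto.
Qed.

Lemma continuity_2d_pt_sqr (f : R -> R -> R) x y :
  continuity_2d_pt f x y -> continuity_2d_pt (fun u v => f u v ^ 2) x y.
Proof.
intros H. apply (continuity_2d_pt_ext (fun u v => f u v * f u v)).
- intros; ring.
- now apply continuity_2d_pt_mult.
Qed.

Lemma continuity_2d_pt_exp (f : R -> R -> R) x y :
  continuity_2d_pt f x y -> continuity_2d_pt (fun u v => exp (f u v)) x y.
Proof.
intros H. apply (continuity_1d_2d_pt_comp exp); [| exact H].
apply derivable_continuous_pt, derivable_pt_exp.
Qed.

Ltac cont2d :=
  repeat first
    [ assumption
    | apply continuity_2d_pt_const
    | apply continuity_2d_pt_id1
    | apply continuity_2d_pt_id2
    | apply continuity_2d_pt_minus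
    | apply continuity_2d_pt_plus
    | apply continuity_2d_pt_mult
    | apply continuity_2d_pt_sqr
    | apply continuity_2d_pt_exp ].

(** * The equation and its derivatives *)

Local Notation "d ^[ i , j ]" := (d i%nat j%nat)
  (at level 2, left associativity, only parsing).

(** [solution D d]: on the open set [D], the family [d] consists of the partial
    derivatives up to order four of the solution [d^[0,0]], where [d^[i,j]] is
    the derivative of order [i] in [x] and [j] in [y].  Carrying the whole family
    makes the commutation of derivatives implicit and the exchange of the two
    variables a mere transposition of the indices.  Positivity is required of
    [u_xx] only; that of [u_yy] follows from the equation. *)
Record solution (D : R -> R -> Prop) (d : nat -> nat -> R -> R -> R) : Prop := {
  sol_open : forall x y, D x y -> locally_2d D x y;
  sol_dx : forall i j x y, (i + j <= 3)%nat -> D x y ->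
    is_derive (fun t => d i j t y) x (d (S i) j x y);
  sol_dy : forall i j x y, (i + j <= 3)%nat -> D x y ->
    is_derive (fun t => d i j x t) y (d i (S j) x y);
  sol_cont : forall i j x y, (i + j <= 4)%nat -> D x y ->
    continuity_2d_pt (d i j) x y;
  sol_eq : forall x y, D x y -> d^[2,0] x y * d^[0,2] x y = 1;
  sol_pos : forall x y, D x y -> 0 < d^[2,0] x y
}.

Lemma solution_swap D d :
  solution D d -> solution (fun x y => D y x) (fun i j x y => d j i y x).
Proof.
intros [So Sx Sy Sc Se Sp]. split.
- intros x y H. apply locally_2d_locally.
  destruct (So _ _ H) as [e He]. exists e. intros [u v] [Hu Hv]. now apply He.
- intros i j x y Hij H. apply Sy; [lia | exact H].
- intros i j x y Hij H. apply Sx; [lia | exact H].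
- intros i j x y Hij H eps. destruct (Sc j i y x ltac:(lia) H eps) as [e He].
  exists e. intros u v Hu Hv. now apply He.
- intros x y H. rewrite Rmult_comm. now apply Se.
- intros x y H. generalize (Se _ _ H) (Sp _ _ H). intros E P.
  apply Rmult_lt_reg_l with (1 := P). rewrite E. lra.
Qed.

Lemma is_derive_prod (f g : R -> R) (x f' g' : R) :
  is_derive f x f' -> is_derive g x g' ->
  is_derive (fun t => f t * g t) x (f' * g x + f x * g').
Proof. intros Hf Hg. apply (is_derive_mult f g); auto. intros; apply Rmult_comm. Qed.

(* Finding the two factors by matching avoids a higher-order unification. *)
Ltac derive_prod :=
  lazymatch goal with
  | |- is_derive (fun t => @?f t * @?g t) _ _ => apply (is_derive_prod f g)
  end.

Lemma sol_pos_yy D d x y : solution D d -> D x y -> 0 < d^[0,2] x y.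
Proof. intros S H. exact (sol_pos _ _ (solution_swap _ _ S) y x H). Qed.

Lemma locally_x D d x y : solution D d -> D x y -> locally x (fun t => D t y).
Proof. intros S H. apply (locally_2d_1d_const_y D), (sol_open _ _ S _ _ H). Qed.

Lemma locally_y D d x y : solution D d -> D x y -> locally y (fun t => D x t).
Proof. intros S H. apply (locally_2d_1d_const_x D), (sol_open _ _ S _ _ H). Qed.

Lemma derive_const_loc (f : R -> R) (c t l : R) :
  locally t (fun s => f s = c) -> is_derive f t l -> l = 0.
Proof.
intros Hc Hd.
assert (H0 : is_derive (fun _ : R => c) t l)
  by (apply is_derive_ext_loc with (2 := Hd); exact Hc).
apply is_derive_unique in H0. rewrite Derive_const in H0. now symmetry.
Qed.

(** The equation [u_xx u_yy = 1] differentiated in [x], in [y], in [x] and [y], and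
    twice in [y]. *)
Lemma equation_x D d x y : solution D d -> D x y ->
  d^[3,0] x y * d^[0,2] x y + d^[2,0] x y * d^[1,2] x y = 0.
Proof.
intros S H.
apply (derive_const_loc (fun t => d^[2,0] t y * d^[0,2] t y) 1 x).
- generalize (locally_x _ _ _ _ S H). apply filter_imp. intros t Ht. now apply (sol_eq _ _ S).
- derive_prod; (apply (sol_dx _ _ S); [lia | exact H]).
Qed.

Lemma equation_y D d x y : solution D d -> D x y ->
  d^[2,1] x y * d^[0,2] x y + d^[2,0] x y * d^[0,3] x y = 0.
Proof.
intros S H. generalize (equation_x _ _ y x (solution_swap _ _ S) H). simpl. lra.
Qed.

Lemma equation_xy D d x y : solution D d -> D x y ->
  d^[0,2] x y * d^[3,1] x y + d^[2,0] x y * d^[1,3] x y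
  = - 2 * d^[2,1] x y * d^[1,2] x y.
Proof.
intros S H.
assert (K : d^[3,1] x y * d^[0,2] x y + d^[2,1] x y * d^[1,2] x y
  + (d^[3,0] x y * d^[0,3] x y + d^[2,0] x y * d^[1,3] x y) = 0).
{ apply (derive_const_loc
   (fun t => d^[2,1] t y * d^[0,2] t y + d^[2,0] t y * d^[0,3] t y) 0 x).
  - generalize (locally_x _ _ _ _ S H). apply filter_imp. intros t Ht.
    now apply (equation_y D d).
  - apply (is_derive_plus (fun t => d^[2,1] t y * d^[0,2] t y) (fun t => d^[2,0] t y * d^[0,3] t y));
    derive_prod; (apply (sol_dx _ _ S); [lia | exact H]). }
assert (E := sol_eq _ _ S _ _ H). assert (P := sol_pos _ _ S _ _ H).
assert (E1 := equation_x _ _ _ _ S H). assert (E2 := equation_y _ _ _ _ S H).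
set (A := d^[2,0] x y) in *. set (B := d^[0,2] x y) in *.
assert (F1 : d^[3,0] x y = - A * A * d^[1,2] x y).
{ transitivity (d^[3,0] x y * (A * B)); [rewrite E; ring |].
  transitivity (A * (d^[3,0] x y * B)); [ring |].
  replace (d^[3,0] x y * B) with (- (A * d^[1,2] x y)) by lra. ring. }
assert (F2 : A * d^[0,3] x y = - B * d^[2,1] x y) by lra.
assert (F3 : d^[3,0] x y * d^[0,3] x y = d^[1,2] x y * d^[2,1] x y).
{ rewrite F1. transitivity (- A * d^[1,2] x y * (A * d^[0,3] x y)); [ring |].
  rewrite F2. transitivity (A * B * (d^[1,2] x y * d^[2,1] x y)); [ring |].
  rewrite E. ring. }
lra.
Qed.

Lemma equation_yy D d x y : solution D d -> D x y ->
  d^[0,2] x y * d^[2,2] x y + d^[2,0] x y * d^[0,4] x y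
  = 2 * (d^[2,1] x y * d^[0,2] x y) ^ 2.
Proof.
intros S H.
assert (K : d^[2,2] x y * d^[0,2] x y + d^[2,1] x y * d^[0,3] x y
  + (d^[2,1] x y * d^[0,3] x y + d^[2,0] x y * d^[0,4] x y) = 0).
{ apply (derive_const_loc
   (fun t => d^[2,1] x t * d^[0,2] x t + d^[2,0] x t * d^[0,3] x t) 0 y).
  - generalize (locally_y _ _ _ _ S H). apply filter_imp. intros t Ht.
    now apply (equation_y D d).
  - apply (is_derive_plus (fun t => d^[2,1] x t * d^[0,2] x t) (fun t => d^[2,0] x t * d^[0,3] x t));
    derive_prod; (apply (sol_dy _ _ S); [lia | exact H]). }
assert (E := sol_eq _ _ S _ _ H). assert (P := sol_pos _ _ S _ _ H).
assert (E2 := equation_y _ _ _ _ S H).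
set (A := d^[2,0] x y) in *. set (B := d^[0,2] x y) in *.
assert (F2 : d^[0,3] x y = - d^[2,1] x y * B * B).
{ apply (Rmult_eq_reg_l A); [| lra].
  transitivity (- (A * B) * (d^[2,1] x y * B)); [| ring]. rewrite E. lra. }
rewrite F2 in K. lra.
Qed.

(** * Bound of the mixed derivative *)

(** The maximum principle for the mixed derivative, at the maximum point, with
    [W = e w] and [e] a sign.  Here [a] and [- b] are the derivatives of the added
    function in [e p] and [q], [s11, s22] are the second derivatives of the logarithm
    of the cutoff, [s1, s2] are [e] times its derivative in [x] and its derivative in
    [y], and likewise [r1, r2] for the logarithm of [W]. *)
Lemma mixed_barrier_algebra (M al a b A B W t s1 s2 s11 s22 r1 r2 : R) :
  1 <= M -> 216 * al * M ^ 2 = 1 ->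
  2 * al * M <= a <= 6 * al * M -> 2 * al * M <= b <= 6 * al * M ->
  0 < A -> 0 < B -> A * B = 1 -> 0 < t ->
  Rabs s1 <= t -> Rabs s2 <= t ->
  - (3 / 2) * t ^ 2 <= s11 -> - (3 / 2) * t ^ 2 <= s22 ->
  r1 + (a * A - b * W + s1) = 0 -> r2 + (a * W - b * B + s2) = 0 ->
  - 2 * W * r1 * r2 - B * r1 ^ 2 - A * r2 ^ 2
    + 2 * al * (A + B) * (1 + W ^ 2) + B * s11 + A * s22 <= 0 ->
  W < 1000 * M * t.
Proof.
intros HM Hal Ha Hb HA HB HAB Ht Hs1 Hs2 Hs11 Hs22 Hr1 Hr2 H.
destruct (Rlt_or_le W (1000 * M * t)) as [|HW]; [assumption | exfalso].
assert (Hal0 : 0 < al) by nra.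
assert (HMt : 0 < M * t) by nra.
assert (HW0 : 0 < W) by nra.
assert (Q1 : s1 ^ 2 <= t ^ 2) by (apply Rabs_le_between in Hs1; nra).
assert (Q2 : s2 ^ 2 <= t ^ 2) by (apply Rabs_le_between in Hs2; nra).
apply Rabs_le_between in Hs1. apply Rabs_le_between in Hs2.
assert (E1 : r1 = - (a * A - b * W + s1)) by lra.
assert (E2 : r2 = - (a * W - b * B + s2)) by lra.
assert (aM : 0 < 2 * al * M) by nra.
assert (Ha2 : 6 * a ^ 2 <= al).
{ assert (a ^ 2 <= (6 * al * M) ^ 2) by (apply pow_incr; lra). nra. }
assert (Hb2 : 6 * b ^ 2 <= al).
{ assert (b ^ 2 <= (6 * al * M) ^ 2) by (apply pow_incr; lra). nra. }
(* Since a and b are at least 1 / (108 M), both a W and b W exceed 9 t. *)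
assert (HX : 9 * t <= a * W).
{ apply Rle_trans with (2 * al * M * (1000 * M * t)).
  - replace (2 * al * M * (1000 * M * t)) with (216 * al * M ^ 2 * (2000 / 216 * t)) by field.
    rewrite Hal. lra.
  - apply Rmult_le_compat; nra. }
assert (HY : 9 * t <= b * W).
{ apply Rle_trans with (2 * al * M * (1000 * M * t)).
  - replace (2 * al * M * (1000 * M * t)) with (216 * al * M ^ 2 * (2000 / 216 * t)) by field.
    rewrite Hal. lra.
  - apply Rmult_le_compat; nra. }
assert (HaW : 4000 * t ^ 2 <= al * W ^ 2).
{ apply Rle_trans with (al * (1000 * M * t) ^ 2).
  - replace (al * (1000 * M * t) ^ 2) with (216 * al * M ^ 2 * (1000000 / 216 * t ^ 2)) by field.
    rewrite Hal. nra.
  - apply Rmult_le_compat_l; [lra |]. apply pow_incr. split; [nra | exact HW]. }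
(* The cubic term absorbs the terms of degree one and two in W. *)
assert (C3 : 0 < 2 * (a * W) * (b * W) - 2 * (a * W + b * W) * t - 2 * t ^ 2) by nra.
assert (C3' : 0 < W * (2 * (a * W) * (b * W) - 2 * (a * W + b * W) * t - 2 * t ^ 2))
  by (apply Rmult_lt_0_compat; assumption).
assert (I1 : - 2 * W * r1 * r2 =
   - 2 * a ^ 2 * A * W ^ 2 + 2 * a * b * W * (A * B) - 2 * a * A * W * s2
   + 2 * a * b * W ^ 3 - 2 * b ^ 2 * W ^ 2 * B + 2 * b * W ^ 2 * s2
   - 2 * a * W ^ 2 * s1 + 2 * b * B * W * s1 - 2 * W * s1 * s2)
  by (rewrite E1, E2; ring).
rewrite HAB in I1.
assert (I2 : B * r1 ^ 2 <= 3 * a ^ 2 * A + 3 * b ^ 2 * W ^ 2 * B + 3 * B * t ^ 2).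
{ apply Rle_trans with (B * (3 * (a * A) ^ 2 + 3 * (b * W) ^ 2 + 3 * t ^ 2)).
  - apply Rmult_le_compat_l; [lra |]. rewrite E1.
    assert (0 <= (a * A + b * W) ^ 2) by apply pow2_ge_0.
    assert (0 <= (a * A - s1) ^ 2) by apply pow2_ge_0.
    assert (0 <= (b * W + s1) ^ 2) by apply pow2_ge_0. lra.
  - right. transitivity (3 * a ^ 2 * A * (A * B) + 3 * b ^ 2 * W ^ 2 * B + 3 * B * t ^ 2); [ring |].
    rewrite HAB. ring. }
assert (I3 : A * r2 ^ 2 <= 3 * a ^ 2 * W ^ 2 * A + 3 * b ^ 2 * B + 3 * A * t ^ 2).
{ apply Rle_trans with (A * (3 * (a * W) ^ 2 + 3 * (b * B) ^ 2 + 3 * t ^ 2)).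
  - apply Rmult_le_compat_l; [lra |]. rewrite E2.
    assert (0 <= (a * W + b * B) ^ 2) by apply pow2_ge_0.
    assert (0 <= (a * W - s2) ^ 2) by apply pow2_ge_0.
    assert (0 <= (b * B + s2) ^ 2) by apply pow2_ge_0. lra.
  - right. transitivity (3 * a ^ 2 * W ^ 2 * A + 3 * b ^ 2 * B * (A * B) + 3 * A * t ^ 2); [ring |].
    rewrite HAB. ring. }
assert (I4 : 2 * a * A * W * s2 <= a ^ 2 * W ^ 2 * A + A * t ^ 2).
{ assert (0 <= A * (a * W - s2) ^ 2) by (apply Rmult_le_pos; [lra | apply pow2_ge_0]).
  assert (A * s2 ^ 2 <= A * t ^ 2) by (apply Rmult_le_compat_l; lra). lra. }
assert (I5 : - (2 * b * B * W * s1) <= b ^ 2 * W ^ 2 * B + B * t ^ 2).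
{ assert (0 <= B * (b * W + s1) ^ 2) by (apply Rmult_le_pos; [lra | apply pow2_ge_0]).
  assert (B * s1 ^ 2 <= B * t ^ 2) by (apply Rmult_le_compat_l; lra). lra. }
assert (I6 : - (2 * b * W ^ 2 * s2) <= 2 * b * W ^ 2 * t).
{ assert (L : 2 * b * W ^ 2 * (- s2) <= 2 * b * W ^ 2 * t); [| lra].
  apply Rmult_le_compat_l; [| lra]. apply Rmult_le_pos; [lra | apply pow2_ge_0]. }
assert (I7 : 2 * a * W ^ 2 * s1 <= 2 * a * W ^ 2 * t).
{ apply Rmult_le_compat_l; [| lra]. apply Rmult_le_pos; [lra | apply pow2_ge_0]. }
assert (I8 : 2 * W * s1 * s2 <= 2 * W * t ^ 2).
{ assert (L : s1 * s2 <= t ^ 2) by (assert (Z := pow2_ge_0 (s1 - s2)); lra).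
  apply (Rmult_le_compat_l (2 * W)) in L; lra. }
assert (I9 : 0 < 2 * a * b * W) by (repeat apply Rmult_lt_0_compat; lra).
assert (J : forall c, 0 < c ->
  6 * a ^ 2 * W ^ 2 * c <= al * W ^ 2 * c /\ 6 * b ^ 2 * W ^ 2 * c <= al * W ^ 2 * c /\
  3 * a ^ 2 * c <= al * c /\ 3 * b ^ 2 * c <= al * c /\
  4000 * t ^ 2 * c <= al * W ^ 2 * c).
{ intros c Hc.
  assert (W2 := pow2_ge_0 W). assert (A2 := pow2_ge_0 a). assert (B2 := pow2_ge_0 b).
  repeat split; apply Rmult_le_compat_r; try lra; apply Rmult_le_compat_r; lra. }
destruct (J A HA) as (JA1 & JA2 & JA3 & JA4 & JA5).
destruct (J B HB) as (JB1 & JB2 & JB3 & JB4 & JB5).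
assert (K1 : B * (- (3 / 2) * t ^ 2) <= B * s11) by (apply Rmult_le_compat_l; lra).
assert (K2 : A * (- (3 / 2) * t ^ 2) <= A * s22) by (apply Rmult_le_compat_l; lra).
assert (0 < al * A) by (apply Rmult_lt_0_compat; lra).
assert (0 < al * B) by (apply Rmult_lt_0_compat; lra).
assert (Ht2 := pow2_ge_0 t).
assert (0 <= t ^ 2 * A) by (apply Rmult_le_pos; lra).
assert (0 <= t ^ 2 * B) by (apply Rmult_le_pos; lra).
lra.
Qed.

Lemma mixed_barrier_derive (e al M s t w1 p1 q1 : R) (w p q : R -> R) :
  is_derive w t w1 -> is_derive p t p1 -> is_derive q t q1 ->
  0 < e * w t -> 0 < s ^ 2 - t ^ 2 ->
  is_derive (fun t => ln (e * w t) + al * (e * p t + 2 * M) ^ 2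
                      + al * (q t - 2 * M) ^ 2 + ln (s ^ 2 - t ^ 2)) t
    (w1 / w t + 2 * al * (e * p t + 2 * M) * (e * p1)
     + 2 * al * (q t - 2 * M) * q1 - 2 * t / (s ^ 2 - t ^ 2)).
Proof.
intros Hw Hp Hq Hpos Hs.
assert (e <> 0) by (intros ->; lra). assert (w t <> 0) by (intros Z; rewrite Z in Hpos; lra).
auto_derive.
- repeat split; try (eexists; eassumption); lra.
- replace (Derive (fun x => w x) t) with w1 by (symmetry; now apply is_derive_unique).
  replace (Derive (fun x => p x) t) with p1 by (symmetry; now apply is_derive_unique).
  replace (Derive (fun x => q x) t) with q1 by (symmetry; now apply is_derive_unique).
  field. repeat split; lra.
Qed.

Lemma mixed_barrier_derive2 (e al M s t w2 p2 q2 : R) (w p q w1 p1 q1 : R -> R) :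
  is_derive w t (w1 t) -> is_derive p t (p1 t) -> is_derive q t (q1 t) ->
  is_derive w1 t w2 -> is_derive p1 t p2 -> is_derive q1 t q2 ->
  w t <> 0 -> 0 < s ^ 2 - t ^ 2 ->
  is_derive (fun t => w1 t / w t + 2 * al * (e * p t + 2 * M) * (e * p1 t)
     + 2 * al * (q t - 2 * M) * q1 t - 2 * t / (s ^ 2 - t ^ 2)) t
    (w2 / w t - (w1 t / w t) ^ 2
     + 2 * al * (e * p1 t) ^ 2 + 2 * al * (e * p t + 2 * M) * (e * p2)
     + 2 * al * q1 t ^ 2 + 2 * al * (q t - 2 * M) * q2
     - (2 / (s ^ 2 - t ^ 2) + 4 * t ^ 2 / (s ^ 2 - t ^ 2) ^ 2)).
Proof.
intros Hw Hp Hq Hw1 Hp1 Hq1 Hw0 Hs.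
auto_derive.
- repeat split; try (eexists; eassumption); try assumption; lra.
- replace (Derive (fun x => w x) t) with (w1 t) by (symmetry; now apply is_derive_unique).
  replace (Derive (fun x => p x) t) with (p1 t) by (symmetry; now apply is_derive_unique).
  replace (Derive (fun x => q x) t) with (q1 t) by (symmetry; now apply is_derive_unique).
  replace (Derive (fun x => w1 x) t) with w2 by (symmetry; now apply is_derive_unique).
  replace (Derive (fun x => p1 x) t) with p2 by (symmetry; now apply is_derive_unique).
  replace (Derive (fun x => q1 x) t) with q2 by (symmetry; now apply is_derive_unique).
  field. repeat split; try assumption; lra.
Qed.

(** Bounds for the first two derivatives of [ln (s^2 - x^2)], in terms of the full
    cutoff [(s^2 - x^2) c], where [c] is the factor in the other variable. *)
Lemma cutoff_bound (s x c : R) :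
  0 < s <= 1 -> Rabs x < s -> 0 < c <= 1 ->
  0 < s ^ 2 - x ^ 2 /\
  Rabs (- 2 * x / (s ^ 2 - x ^ 2)) <= 2 / ((s ^ 2 - x ^ 2) * c) /\
  - (3 / 2) * (2 / ((s ^ 2 - x ^ 2) * c)) ^ 2
    <= - (2 / (s ^ 2 - x ^ 2) + 4 * x ^ 2 / (s ^ 2 - x ^ 2) ^ 2).
Proof.
intros Hs Hx Hc. apply Rabs_def2 in Hx.
assert (Hk : 0 < s ^ 2 - x ^ 2) by nra.
assert (Hk1 : s ^ 2 - x ^ 2 <= 1) by nra.
set (k := s ^ 2 - x ^ 2) in *.
assert (Hi : 1 <= / k) by (rewrite <- Rinv_1; apply Rinv_le_contravar; lra).
assert (Hic : 1 <= / c) by (rewrite <- Rinv_1; apply Rinv_le_contravar; lra).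
replace (2 / (k * c)) with (2 * (/ k * / c)) by (field; lra).
assert (H1 : / k <= / k * / c) by nra.
split; [exact Hk | split].
- replace (- 2 * x / k) with (- 2 * x * / k) by reflexivity.
  apply Rabs_le. split; nra.
- replace (2 / k) with (2 * / k) by reflexivity.
  replace (4 * x ^ 2 / k ^ 2) with (4 * x ^ 2 * (/ k * / k)) by (field; lra).
  assert (H2 : / k * / k <= (/ k * / c) ^ 2) by nra.
  assert (H3 : / k <= / k * / k) by nra.
  assert (H4 : x ^ 2 * (/ k * / k) <= 1 * (/ k * / k)) by (apply Rmult_le_compat_r; nra).
  lra.
Qed.

(** First and second order conditions on a slice, in either variable, at a maximum
    of the barrier; [c] is the cutoff factor in the other variable. *)
Lemma mixed_barrier_slice (e al M s c t0 : R) (w p q w1 p1 q1 : R -> R) (w2 p2 q2 : R) :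
  0 < e * w t0 -> - s < t0 < s -> 0 < c ->
  locally t0 (fun t => is_derive w t (w1 t) /\ is_derive p t (p1 t) /\ is_derive q t (q1 t)) ->
  is_derive w1 t0 w2 -> is_derive p1 t0 p2 -> is_derive q1 t0 q2 ->
  locally t0 (fun t =>
    c * ((s ^ 2 - t ^ 2) * (e * w t)
      * exp (al * (e * p t + 2 * M) ^ 2 + al * (q t - 2 * M) ^ 2)) <=
    c * ((s ^ 2 - t0 ^ 2) * (e * w t0)
      * exp (al * (e * p t0 + 2 * M) ^ 2 + al * (q t0 - 2 * M) ^ 2))) ->
  w1 t0 / w t0 + 2 * al * (e * p t0 + 2 * M) * (e * p1 t0)
     + 2 * al * (q t0 - 2 * M) * q1 t0 - 2 * t0 / (s ^ 2 - t0 ^ 2) = 0 /\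
  w2 / w t0 - (w1 t0 / w t0) ^ 2
     + 2 * al * (e * p1 t0) ^ 2 + 2 * al * (e * p t0 + 2 * M) * (e * p2)
     + 2 * al * q1 t0 ^ 2 + 2 * al * (q t0 - 2 * M) * q2
     - (2 / (s ^ 2 - t0 ^ 2) + 4 * t0 ^ 2 / (s ^ 2 - t0 ^ 2) ^ 2) <= 0.
Proof.
intros HW Ht0 Hc Hd Hw2 Hp2 Hq2 Hmax.
destruct (locally_singleton _ _ Hd) as (Hw1 & Hp1 & Hq1).
assert (Hk : 0 < s ^ 2 - t0 ^ 2) by nra.
assert (Hw0 : w t0 <> 0) by (intros Z; rewrite Z in HW; lra).
assert (Hpos : locally t0 (fun t => 0 < e * w t /\ 0 < s ^ 2 - t ^ 2)).
{ apply filter_and.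
  - apply (locally_pos _ _ (e * w1 t0)); [| exact HW].
    apply (is_derive_scal w t0 e (w1 t0) Hw1).
  - generalize (locally_interior _ _ _ Ht0). apply filter_imp. intros; nra. }
apply (second_derivative_test
  (fun t => ln (e * w t) + al * (e * p t + 2 * M) ^ 2
            + al * (q t - 2 * M) ^ 2 + ln (s ^ 2 - t ^ 2))
  (fun t => w1 t / w t + 2 * al * (e * p t + 2 * M) * (e * p1 t)
     + 2 * al * (q t - 2 * M) * q1 t - 2 * t / (s ^ 2 - t ^ 2))).
- generalize (filter_and _ _ Hd Hpos). apply filter_imp.
  intros t [(Hw & Hp & Hq) [Hwp Hkp]].
  exact (mixed_barrier_derive e al M s t _ _ _ w p q Hw Hp Hq Hwp Hkp).
- now apply mixed_barrier_derive2.
- apply (local_max_of_exp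
    (fun t => c * ((s ^ 2 - t ^ 2) * (e * w t)
       * exp (al * (e * p t + 2 * M) ^ 2 + al * (q t - 2 * M) ^ 2)))
    (fun t => ln (e * w t) + al * (e * p t + 2 * M) ^ 2
            + al * (q t - 2 * M) ^ 2 + ln (s ^ 2 - t ^ 2)) c t0 Hc) with (2 := Hmax).
  generalize Hpos. apply filter_imp. intros t [Hwp Hkp].
  rewrite !exp_plus, !exp_ln by assumption. ring.
Qed.

(** The sign [e] is [1] or [-1], so that the two cases give the upper and the lower
    bound of the mixed derivative. *)
Lemma mixed_derivative_bound D d (e M s : R) :
  solution D d -> e * e = 1 -> 1 <= M -> 0 < s <= 1 ->
  (forall x y, Rabs x <= s -> Rabs y <= s ->
     D x y /\ Rabs (d^[1,0] x y) <= M /\ Rabs (d^[0,1] x y) <= M) ->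
  forall x y, Rabs x <= s -> Rabs y <= s ->
    (s ^ 2 - x ^ 2) * (s ^ 2 - y ^ 2) * (e * d^[1,1] x y) <= 6000 * M.
Proof.
intros S He HM Hs HD.
(* As p + 2 M and 2 M - q lie between M and 3 M, this constant makes six times the
   square of the first derivatives of the added functions at most al. *)
set (al := / (216 * M ^ 2)).
assert (Hal : 216 * al * M ^ 2 = 1) by (unfold al; field; lra).
assert (Hal0 : 0 < al) by (unfold al; apply Rinv_0_lt_compat; nra).
clearbody al.
assert (Hal1 : forall z, M <= z <= 3 * M -> 2 * al * M <= 2 * al * z <= 6 * al * M)
  by (clear - Hal0; intros z Hz; split; nra).
assert (Habs : Rabs e = 1).
{ assert (Z : Rabs e * Rabs e = 1) by (rewrite <- Rabs_mult, He; apply Rabs_R1).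
  assert (Z' := Rabs_pos e). clear - Z Z'. nra. }
assert (He1 : forall p, Rabs p <= M -> - M <= e * p <= M).
{ intros p Hp. apply Rabs_le_between in Hp.
  assert (e = 1 \/ e = -1) as [-> | ->] 
    by (assert (Z : (e - 1) * (e + 1) = 0) by lra;
        apply Rmult_integral in Z; destruct Z; [left | right]; lra); lra. }
set (E := fun x y => al * (e * d^[1,0] x y + 2 * M) ^ 2 + al * (d^[0,1] x y - 2 * M) ^ 2).
assert (HE : forall x y, Rabs x <= s -> Rabs y <= s -> 0 <= E x y <= 1).
{ intros x y Hx Hy. destruct (HD x y Hx Hy) as (_ & Hp & Hq).
  apply He1 in Hp. apply Rabs_le_between in Hq. unfold E.
  generalize dependent (e * d^[1,0] x y). generalize dependent (d^[0,1] x y).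
  intros q Hq p Hp.
  assert (H1 : 0 <= (p + 2 * M) ^ 2 <= (3 * M) ^ 2) by (split; [apply pow2_ge_0 | apply pow_incr; lra]).
  assert (H2 : 0 <= (q - 2 * M) ^ 2 <= (3 * M) ^ 2).
  { split; [apply pow2_ge_0 |]. rewrite <- (Rsqr_pow2 (q - 2 * M)), Rsqr_neg, Rsqr_pow2.
    apply pow_incr; lra. }
  split.
  - apply Rplus_le_le_0_compat; apply Rmult_le_pos; lra.
  - assert (al * (p + 2 * M) ^ 2 <= al * (3 * M) ^ 2) by (apply Rmult_le_compat_l; lra).
    assert (al * (q - 2 * M) ^ 2 <= al * (3 * M) ^ 2) by (apply Rmult_le_compat_l; lra).
    lra. }
set (psi := fun x y => (s ^ 2 - x ^ 2) * (s ^ 2 - y ^ 2) * (e * d^[1,1] x y) * exp (E x y)).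
assert (Hin : forall x, - s <= x <= s -> Rabs x <= s) by (intros; apply Rabs_le; lra).
destruct (rectangle_max psi (-s) s (-s) s) as (x0 & y0 & Hx0 & Hy0 & Hmax); try lra.
{ intros x y Hx Hy. destruct (HD x y (Hin _ Hx) (Hin _ Hy)) as (HDxy & _ & _).
  assert (C11 := sol_cont _ _ S 1 1 x y ltac:(lia) HDxy).
  assert (C10 := sol_cont _ _ S 1 0 x y ltac:(lia) HDxy).
  assert (C01 := sol_cont _ _ S 0 1 x y ltac:(lia) HDxy).
  unfold psi, E. cont2d. }
destruct (HD x0 y0 (Hin _ Hx0) (Hin _ Hy0)) as (HD0 & Hp0 & Hq0).
set (A := d^[2,0] x0 y0) in *. set (B := d^[0,2] x0 y0) in *.
set (w := d^[1,1] x0 y0) in *. set (W := e * w).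
set (eta := (s ^ 2 - x0 ^ 2) * (s ^ 2 - y0 ^ 2)).
assert (Hsq : forall x, - s <= x <= s -> 0 <= s ^ 2 - x ^ 2 <= 1) by (intros; nra).
assert (Heta : 0 <= eta <= 1).
{ generalize (Hsq x0 Hx0) (Hsq y0 Hy0). unfold eta. intros. split; nra. }
assert (Main : eta * W <= 2000 * M).
{ destruct (Rle_or_lt (eta * W) 0) as [N | P]; [lra |].
  assert (Heta0 : 0 < eta) by (destruct (proj1 Heta) as [? | <-]; [assumption | lra]).
  assert (HW : 0 < W) by nra.
  assert (Hkx : 0 < s ^ 2 - x0 ^ 2) by (generalize (Hsq x0 Hx0) (Hsq y0 Hy0); unfold eta in *; intros; nra).
  assert (Hky : 0 < s ^ 2 - y0 ^ 2) by (generalize (Hsq x0 Hx0) (Hsq y0 Hy0); unfold eta in *; intros; nra).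
  assert (Hx0' : - s < x0 < s) by (split; nra).
  assert (Hy0' : - s < y0 < s) by (split; nra).
  assert (Hw0 : w <> 0) by (intros Z; unfold W in HW; rewrite Z in HW; lra).
  assert (Lmax : forall x y, Rabs x <= s -> Rabs y <= s -> psi x y <= psi x0 y0)
    by (intros x y Hx Hy; apply Hmax; now apply Rabs_le_between).
  destruct (mixed_barrier_slice e al M s (s ^ 2 - y0 ^ 2) x0
    (fun t => d^[1,1] t y0) (fun t => d^[1,0] t y0) (fun t => d^[0,1] t y0)
    (fun t => d^[2,1] t y0) (fun t => d^[2,0] t y0) (fun t => d^[1,1] t y0)
    (d^[3,1] x0 y0) (d^[3,0] x0 y0) (d^[2,1] x0 y0)) as [Gx1 Gx2];
    [ exact HW | exact Hx0' | exact Hky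
    | generalize (locally_x _ _ _ _ S HD0); apply filter_imp; intros t Ht;
      repeat split; (apply (sol_dx _ _ S); [lia | exact Ht])
    | apply (sol_dx _ _ S); [lia | exact HD0]
    | apply (sol_dx _ _ S); [lia | exact HD0]
    | apply (sol_dx _ _ S); [lia | exact HD0]
    | generalize (locally_interior (-s) s x0 Hx0'); apply filter_imp; intros t Ht;
      generalize (Lmax t y0 ltac:(apply Rabs_le; lra) ltac:(apply Rabs_le; lra));
      unfold psi, E; lra
    |].
  destruct (mixed_barrier_slice e al M s (s ^ 2 - x0 ^ 2) y0
    (fun t => d^[1,1] x0 t) (fun t => d^[1,0] x0 t) (fun t => d^[0,1] x0 t)
    (fun t => d^[1,2] x0 t) (fun t => d^[1,1] x0 t) (fun t => d^[0,2] x0 t)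
    (d^[1,3] x0 y0) (d^[1,2] x0 y0) (d^[0,3] x0 y0)) as [Gy1 Gy2];
    [ exact HW | exact Hy0' | exact Hkx
    | generalize (locally_y _ _ _ _ S HD0); apply filter_imp; intros t Ht;
      repeat split; (apply (sol_dy _ _ S); [lia | exact Ht])
    | apply (sol_dy _ _ S); [lia | exact HD0]
    | apply (sol_dy _ _ S); [lia | exact HD0]
    | apply (sol_dy _ _ S); [lia | exact HD0]
    | generalize (locally_interior (-s) s y0 Hy0'); apply filter_imp; intros t Ht;
      generalize (Lmax x0 t ltac:(apply Rabs_le; lra) ltac:(apply Rabs_le; lra));
      unfold psi, E; lra
    |].
  cbv beta in Gx1, Gx2, Gy1, Gy2.
  assert (HA := sol_pos _ _ S _ _ HD0). assert (HB := sol_pos_yy _ _ _ _ S HD0).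
  assert (HAB := sol_eq _ _ S _ _ HD0).
  assert (Ex := equation_x _ _ _ _ S HD0). assert (Ey := equation_y _ _ _ _ S HD0).
  assert (Exy := equation_xy _ _ _ _ S HD0).
  fold A B w in HA, HB, HAB, Ex, Ey, Exy, Gx1, Gx2, Gy1, Gy2.
  destruct (cutoff_bound s x0 (s ^ 2 - y0 ^ 2)) as (_ & Bx1 & Bx2);
    [lra | apply Rabs_def1; lra | generalize (Hsq y0 Hy0); lra |].
  destruct (cutoff_bound s y0 (s ^ 2 - x0 ^ 2)) as (_ & By1 & By2);
    [lra | apply Rabs_def1; lra | generalize (Hsq x0 Hx0); lra |].
  rewrite (Rmult_comm (s ^ 2 - y0 ^ 2)) in By1, By2. fold eta in Bx1, Bx2, By1, By2.
  set (kx := 2 / (s ^ 2 - x0 ^ 2) + 4 * x0 ^ 2 / (s ^ 2 - x0 ^ 2) ^ 2) in *.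
  set (ky := 2 / (s ^ 2 - y0 ^ 2) + 4 * y0 ^ 2 / (s ^ 2 - y0 ^ 2) ^ 2) in *.
  assert (Bx1' : Rabs (e * (- 2 * x0 / (s ^ 2 - x0 ^ 2))) <= 2 / eta).
  { rewrite Rabs_mult. rewrite Habs. lra. }
  assert (Hp := He1 _ Hp0). assert (Hq := proj1 (Rabs_le_between _ _) Hq0).
  set (p := d^[1,0] x0 y0) in *. set (q := d^[0,1] x0 y0) in *.
  set (r1 := d^[2,1] x0 y0 / w) in *. set (r2 := d^[1,2] x0 y0 / w) in *.
  assert (HWt : W < 1000 * M * (2 / eta)).
  { apply (mixed_barrier_algebra M al (2 * al * (e * p + 2 * M)) (2 * al * (2 * M - q))
      A B W (2 / eta) (e * (- 2 * x0 / (s ^ 2 - x0 ^ 2))) (- 2 * y0 / (s ^ 2 - y0 ^ 2))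
      (- kx) (- ky) (e * r1) r2); try assumption.
    - apply Hal1; lra.
    - apply Hal1; lra.
    - apply Rdiv_lt_0_compat; lra.
    - apply (f_equal (Rmult e)) in Gx1. rewrite Rmult_0_r in Gx1. rewrite <- Gx1.
      transitivity (e * r1 + (2 * al * (e * p + 2 * M) * A * (e * e)
        - 2 * al * (2 * M - q) * W + e * (- 2 * x0 / (s ^ 2 - x0 ^ 2)))); [rewrite He; ring |].
      unfold W. unfold Rdiv. ring.
    - rewrite <- Gy1. unfold W, Rdiv. ring.
    - apply (Rmult_le_compat_l B) in Gx2; [| lra]. apply (Rmult_le_compat_l A) in Gy2; [| lra].
      rewrite Rmult_0_r in Gx2, Gy2.
      assert (T1 : B * (d^[3,1] x0 y0 / w) + A * (d^[1,3] x0 y0 / w) = - 2 * W * (e * r1) * r2).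
      { transitivity ((B * d^[3,1] x0 y0 + A * d^[1,3] x0 y0) / w); [field; exact Hw0 |].
        rewrite Exy. unfold W, r1, r2.
        transitivity (- 2 * d^[2,1] x0 y0 * d^[1,2] x0 y0 / w * (e * e));
          [rewrite He; field; exact Hw0 | field; exact Hw0]. }
      assert (T2 : (e * r1) ^ 2 = r1 ^ 2)
        by (transitivity (e * e * r1 ^ 2); [ring | rewrite He; ring]).
      assert (T3 : W ^ 2 = w ^ 2)
        by (unfold W; transitivity (e * e * w ^ 2); [ring | rewrite He; ring]).
      assert (T4 : (e * A) ^ 2 = A ^ 2)
        by (transitivity (e * e * A ^ 2); [ring | rewrite He; ring]).
      assert (T5 : (e * w) ^ 2 = w ^ 2) by exact T3.
      assert (T6 : B * (2 * al * (e * p + 2 * M) * (e * d^[3,0] x0 y0))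
                   + A * (2 * al * (e * p + 2 * M) * (e * d^[1,2] x0 y0)) = 0).
      { transitivity (2 * al * (e * p + 2 * M) * e
          * (d^[3,0] x0 y0 * B + A * d^[1,2] x0 y0)); [ring | rewrite Ex; ring]. }
      assert (T7 : B * (2 * al * (q - 2 * M) * d^[2,1] x0 y0)
                   + A * (2 * al * (q - 2 * M) * d^[0,3] x0 y0) = 0).
      { transitivity (2 * al * (q - 2 * M)
          * (d^[2,1] x0 y0 * B + A * d^[0,3] x0 y0)); [ring | rewrite Ey; ring]. }
      assert (T8 : B * (2 * al * A ^ 2) + B * (2 * al * w ^ 2)
                   + A * (2 * al * w ^ 2) + A * (2 * al * B ^ 2)
                   = 2 * al * (A + B) * (1 + w ^ 2)).
      { transitivity (2 * al * (A * (A * B) + B * (A * B) + (A + B) * w ^ 2));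
          [ring | rewrite HAB; ring]. }
      rewrite T4 in Gx2. rewrite T5 in Gy2. rewrite T2, T3, <- T1, <- T8.
      lra. }
  apply (Rmult_lt_compat_l eta) in HWt; [| exact Heta0].
  replace (eta * (1000 * M * (2 / eta))) with (2000 * M) in HWt by (field; lra). lra. }
intros x y Hx Hy.
assert (HE0 := HE x0 y0 (Hin _ Hx0) (Hin _ Hy0)). assert (HE1 := HE x y Hx Hy).
assert (U0 : exp (E x0 y0) <= 3).
{ apply Rle_trans with (exp 1); [| apply exp_le_3].
  destruct (proj2 HE0) as [L | ->]; [apply Rlt_le, exp_increasing, L | lra]. }
assert (U1 : 1 <= exp (E x y)).
{ rewrite <- exp_0. destruct (proj1 HE1) as [L | <-]; [apply Rlt_le, exp_increasing, L | lra]. }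
assert (L := Hmax x y (proj1 (Rabs_le_between _ _) Hx) (proj1 (Rabs_le_between _ _) Hy)).
assert (U2 : psi x0 y0 <= 6000 * M).
{ assert (0 < exp (E x0 y0)) by apply exp_pos.
  change (psi x0 y0) with (eta * W * exp (E x0 y0)).
  destruct (Rle_or_lt (eta * W) 0) as [N | P]; [nra |].
  apply Rle_trans with (2000 * M * 3); [apply Rmult_le_compat; lra | lra]. }
unfold psi at 1 in L. set (k := (s ^ 2 - x ^ 2) * (s ^ 2 - y ^ 2) * (e * d^[1,1] x y)) in *.
destruct (Rle_or_lt k 0); nra.
Qed.

(** * Lower bound for the increments of the slope *)

(** A form of the Cauchy-Schwarz inequality for the integrals of [A] and of
    [B = 1 / A] on an interval of length [r]. *)
Lemma inverse_integral_lower_bound (A B : R -> R) (a r m IA IB : R) :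
  0 < r -> 0 < m ->
  (forall x, a <= x <= a + r -> 0 < A x /\ A x * B x = 1) ->
  is_RInt A a (a + r) IA -> is_RInt B a (a + r) IB -> IA <= m ->
  r ^ 2 / m <= IB.
Proof.
intros Hr Hm HAB HA HB HI.
set (k := r / m).
assert (Hk : 0 < k) by (apply Rdiv_lt_0_compat; lra).
assert (HC : is_RInt (fun x => 2 * k - k ^ 2 * A x) a (a + r)
   (2 * k * r - k ^ 2 * IA)).
{ replace (2 * k * r) with (scal (a + r - a) (2 * k)) by (unfold scal; simpl; unfold mult; simpl; ring).
  apply (is_RInt_minus (fun _ => 2 * k) (fun x => k ^ 2 * A x)).
  - apply (is_RInt_const a (a + r) (2 * k)).
  - apply (is_RInt_scal A a (a + r) (k ^ 2) IA HA). }
apply Rle_trans with (2 * k * r - k ^ 2 * IA).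
- assert (k ^ 2 * IA <= k ^ 2 * m) by (apply Rmult_le_compat_l; [apply pow2_ge_0 | exact HI]).
  replace (r ^ 2 / m) with (2 * k * r - k ^ 2 * m) by (unfold k; field; lra). lra.
- apply (is_RInt_le _ _ a (a + r) _ _ ltac:(lra) HC HB).
  intros x Hx. destruct (HAB x ltac:(lra)) as [HAx E].
  (* B = 1 / A >= 2 k - k^2 A, from (k A - 1)^2 >= 0. *)
  assert (Q : 0 <= B x * (k * A x - 1) ^ 2).
  { apply Rmult_le_pos; [| apply pow2_ge_0].
    apply Rlt_le, (Rmult_lt_reg_l (A x) _ _ HAx). lra. }
  replace (B x * (k * A x - 1) ^ 2)
    with (k ^ 2 * A x * (A x * B x) - 2 * k * (A x * B x) + B x) in Q by ring.
  rewrite E in Q. lra.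
Qed.

(** The first derivative [u_x] increases by a definite amount over a horizontal
    segment of length [r]. *)
Lemma slope_increment_lower_bound D d (M W a r y0 : R) :
  solution D d -> 0 < r -> 0 < W ->
  (forall x y, a <= x <= a + r -> y0 - r <= y <= y0 + 2 * r ->
     D x y /\ Rabs (d^[0,1] x y) <= M /\ Rabs (d^[1,1] x y) <= W) ->
  2 * W * r * exp (- (4 * M * W / r)) <= d^[1,0] (a + r) y0 - d^[1,0] a y0.
Proof.
intros S Hr HW HD.
set (m := fun y => d^[1,0] (a + r) y - d^[1,0] a y).
assert (HD' : forall x y, a <= x <= a + r -> y0 <= y <= y0 + r -> D x y)
  by (intros; apply HD; lra).
assert (IA : forall y, y0 <= y <= y0 + r ->
   is_RInt (fun x => d^[2,0] x y) a (a + r) (m y)).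
{ intros y Hy.
  apply (is_RInt_derive (fun x => d^[1,0] x y) (fun x => d^[2,0] x y));
    rewrite Rmin_left, Rmax_right by lra; intros x Hx.
  - apply (sol_dx _ _ S); [lia | now apply HD'].
  - apply (ex_derive_continuous (fun x => d^[2,0] x y)). exists (d^[3,0] x y).
    apply (sol_dx _ _ S); [lia | now apply HD']. }
assert (Hm0 : 0 < m y0).
{ destruct (mean_value (fun x => d^[1,0] x y0) (fun x => d^[2,0] x y0) a (a + r))
    as (c & Hc & E); [lra | |].
  - intros x Hx. apply (sol_dx _ _ S); [lia | apply HD'; lra].
  - unfold m. rewrite E. apply Rmult_lt_0_compat; [| lra].
    apply (sol_pos _ _ S), HD'; lra. }
assert (Hm : forall y, y0 <= y <= y0 + r -> m y <= m y0 + 2 * W * (y - y0)).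
{ intros y Hy.
  destruct (mean_value m (fun y => d^[1,1] (a + r) y - d^[1,1] a y) y0 y)
    as (c & Hc & E); [lra | |].
  - intros z Hz. apply (is_derive_minus (fun y => d^[1,0] (a + r) y) (fun y => d^[1,0] a y));
      apply (sol_dy _ _ S); try lia; apply HD'; lra.
  - destruct (HD (a + r) c ltac:(lra) ltac:(lra)) as (_ & _ & K1).
    destruct (HD a c ltac:(lra) ltac:(lra)) as (_ & _ & K2).
    apply Rabs_le_between in K1. apply Rabs_le_between in K2.
    assert ((d^[1,1] (a + r) c - d^[1,1] a c) * (y - y0) <= 2 * W * (y - y0))
      by (apply Rmult_le_compat_r; lra).
    lra. }
set (N := fun y => RInt (fun x => d^[0,1] x y) a (a + r)).
assert (Hex : forall y j, (j <= 2)%nat -> y0 - r <= y <= y0 + 2 * r ->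
   ex_RInt (fun x => d 0%nat j x y) a (a + r)).
{ intros y j Hj Hy. apply (ex_RInt_continuous (fun x => d 0%nat j x y)).
  rewrite Rmin_left, Rmax_right by lra. intros x Hx.
  apply (ex_derive_continuous (fun x => d 0%nat j x y)). exists (d 1%nat j x y).
  apply (sol_dx _ _ S); [lia | now apply HD]. }
assert (HN : forall y, y0 <= y <= y0 + r ->
   is_derive N y (RInt (fun x => d^[0,2] x y) a (a + r))).
{ intros y Hy.
  replace (RInt (fun x => d^[0,2] x y) a (a + r))
    with (RInt (fun x => Derive (fun z => d^[0,1] x z) y) a (a + r)).
  - apply (is_derive_RInt_param (fun z x => d^[0,1] x z) a (a + r) y).
    + generalize (locally_interior (y0 - r) (y0 + 2 * r) y ltac:(lra)).
      apply filter_imp. intros z Hz x. rewrite Rmin_left, Rmax_right by lra. intros Hx.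
      exists (d^[0,2] x z). apply (sol_dy _ _ S); [lia | apply HD; lra].
    + intros x. rewrite Rmin_left, Rmax_right by lra. intros Hx.
      assert (S' := solution_swap _ _ S).
      apply (continuity_2d_pt_ext_loc (fun u v => d^[0,2] v u)).
      * apply (locally_2d_impl (fun u v => D v u)).
        -- apply locally_2d_forall. intros u v Huv. symmetry.
           apply is_derive_unique, (sol_dy _ _ S); [lia | exact Huv].
        -- apply (sol_open _ _ S'). now apply HD'.
      * apply (sol_cont _ _ S' 2 0); [lia | now apply HD'].
    + generalize (locally_interior (y0 - r) (y0 + 2 * r) y ltac:(lra)).
      apply filter_imp. intros z Hz. apply Hex; [lia | lra].
  - apply RInt_ext. rewrite Rmin_left, Rmax_right by lra. intros x Hx.
    apply is_derive_unique, (sol_dy _ _ S); [lia | apply HD'; lra]. }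
assert (HNM : forall y, y0 <= y <= y0 + r -> Rabs (N y) <= M * r).
{ intros y Hy.
  replace (M * r) with ((a + r - a) * M) by ring.
  apply (abs_RInt_le_const (fun x => d^[0,1] x y)); [lra | apply Hex; [lia | lra] |].
  intros x Hx. apply HD; lra. }
(* This function of y is nondecreasing, and N varies by at most 2 M r. *)
destruct (mean_value
  (fun y => N y - r ^ 2 / (2 * W) * ln (m y0 + 2 * W * (y - y0)))
  (fun y => RInt (fun x => d^[0,2] x y) a (a + r) - r ^ 2 / (m y0 + 2 * W * (y - y0)))
  y0 (y0 + r)) as (c & Hc & E); [lra | |].
{ intros y Hy. apply (is_derive_minus N (fun y => r ^ 2 / (2 * W) * ln (m y0 + 2 * W * (y - y0)))).
  - now apply HN.
  - auto_derive; [nra | field; split; nra]. }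
assert (Hc' : 0 <= RInt (fun x => d^[0,2] x c) a (a + r) - r ^ 2 / (m y0 + 2 * W * (c - y0))).
{ apply -> Rminus_le_0.
  apply (inverse_integral_lower_bound (fun x => d^[2,0] x c) (fun x => d^[0,2] x c) a r _ (m c)).
  - exact Hr.
  - nra.
  - intros x Hx. split; [apply (sol_pos _ _ S) | apply (sol_eq _ _ S)]; now apply HD'.
  - now apply IA.
  - apply (RInt_correct (fun x => d^[0,2] x c)), Hex; [lia | lra].
  - now apply Hm. }
assert (E' : r ^ 2 / (2 * W) * (ln (m y0 + 2 * W * r) - ln (m y0)) <= 2 * M * r).
{ replace (m y0 + 2 * W * (y0 + r - y0)) with (m y0 + 2 * W * r) in E by ring.
  replace (m y0 + 2 * W * (y0 - y0)) with (m y0) in E by ring.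
  assert (K1 := HNM y0 ltac:(lra)). assert (K2 := HNM (y0 + r) ltac:(lra)).
  apply Rabs_le_between in K1. apply Rabs_le_between in K2.
  assert (0 <= (RInt (fun x => d^[0,2] x c) a (a + r) - r ^ 2 / (m y0 + 2 * W * (c - y0)))
     * (y0 + r - y0)) by (apply Rmult_le_pos; lra).
  lra. }
assert (E2 : ln (2 * W * r) - 4 * M * W / r <= ln (m y0)).
{ apply (Rmult_le_compat_l (2 * W / r ^ 2)) in E'.
  - replace (2 * W / r ^ 2 * (r ^ 2 / (2 * W) * (ln (m y0 + 2 * W * r) - ln (m y0))))
      with (ln (m y0 + 2 * W * r) - ln (m y0)) in E' by (field; lra).
    replace (2 * W / r ^ 2 * (2 * M * r)) with (4 * M * W / r) in E' by (field; lra).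
    assert (ln (2 * W * r) < ln (m y0 + 2 * W * r)) by (apply ln_increasing; nra).
    lra.
  - apply Rlt_le, Rdiv_lt_0_compat; [lra | apply pow_lt, Hr]. }
assert (Hpos : 0 < 2 * W * r) by nra.
rewrite <- (exp_ln (2 * W * r)) at 1 by exact Hpos. rewrite <- exp_plus.
change (d^[1,0] (a + r) y0 - d^[1,0] a y0) with (m y0).
rewrite <- (exp_ln (m y0)) by exact Hm0.
destruct (Req_dec (ln (2 * W * r) + - (4 * M * W / r)) (ln (m y0))) as [-> | Ne]; [lra |].
apply Rlt_le, exp_increasing. lra.
Qed.

(** * Bound of the pure second derivatives *)

(** First and second order conditions on a slice at a maximum of the barrier
    [B exp (c (t - xc)^2) eta]; the slice in [x] has [c = 1], that in [y] has
    [c = 0]. *)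
Lemma pure_barrier_slice (c xc t0 : R) (B eta B1 eta1 : R -> R) (B2 eta2 : R) :
  0 < B t0 -> 0 < eta t0 ->
  locally t0 (fun t => is_derive B t (B1 t) /\ is_derive eta t (eta1 t)) ->
  is_derive B1 t0 B2 -> is_derive eta1 t0 eta2 ->
  locally t0 (fun t => B t * exp (c * (t - xc) ^ 2) * eta t
                       <= B t0 * exp (c * (t0 - xc) ^ 2) * eta t0) ->
  B1 t0 / B t0 + 2 * c * (t0 - xc) + eta1 t0 / eta t0 = 0 /\
  B2 / B t0 - (B1 t0 / B t0) ^ 2 + 2 * c
    + eta2 / eta t0 - (eta1 t0 / eta t0) ^ 2 <= 0.
Proof.
intros HB He Hd HB2 He2 Hmax.
destruct (locally_singleton _ _ Hd) as (HB1 & He1).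
assert (Hpos : locally t0 (fun t => 0 < B t /\ 0 < eta t)).
{ apply filter_and; eapply locally_pos; eassumption. }
apply (second_derivative_test
  (fun t => ln (B t) + c * (t - xc) ^ 2 + ln (eta t))
  (fun t => B1 t / B t + 2 * c * (t - xc) + eta1 t / eta t)).
- generalize (filter_and _ _ Hd Hpos). apply filter_imp.
  intros t [(HBt & Het) [HBp Hep]]. auto_derive.
  + repeat split; try (eexists; eassumption); assumption.
  + replace (Derive (fun x => B x) t) with (B1 t) by (symmetry; now apply is_derive_unique).
    replace (Derive (fun x => eta x) t) with (eta1 t) by (symmetry; now apply is_derive_unique).
    field. split; lra.
- auto_derive.
  + repeat split; try (eexists; eassumption); lra.
  + replace (Derive (fun x => B x) t0) with (B1 t0) by (symmetry; now apply is_derive_unique).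
    replace (Derive (fun x => eta x) t0) with (eta1 t0) by (symmetry; now apply is_derive_unique).
    replace (Derive (fun x => B1 x) t0) with B2 by (symmetry; now apply is_derive_unique).
    replace (Derive (fun x => eta1 x) t0) with eta2 by (symmetry; now apply is_derive_unique).
    field. split; lra.
- apply (local_max_of_exp (fun t => B t * exp (c * (t - xc) ^ 2) * eta t)
    (fun t => ln (B t) + c * (t - xc) ^ 2 + ln (eta t)) 1 t0 ltac:(lra)) with (2 := Hmax).
  generalize Hpos. apply filter_imp. intros t [HBp Hep].
  rewrite !exp_plus, !exp_ln by assumption. ring.
Qed.

(** The maximum principle for [u_yy], at the maximum point, where [P = p - p0],
    [X = x - x0] and [Y = y - y0].  The contribution of the derivatives in [y] of
    [ln B] and of [ln eta] cancels the right-hand side of [equation_yy]. *)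
Lemma pure_barrier_algebra (A B A1 B2 B11 B22 w w1 w2 P X Y eta c W : R) :
  0 < A -> 0 < B -> A * B = 1 ->
  A1 * B + A * w2 = 0 -> w1 * B + A * B2 = 0 ->
  B * B11 + A * B22 = 2 * (w1 * B) ^ 2 ->
  0 < c -> 0 < W -> Rabs w <= W -> Rabs X <= 1 / 10 ->
  eta = c ^ 2 - P ^ 2 - W ^ 2 * Y ^ 2 -> 0 < eta ->
  w2 / B + 2 * X + - 2 * P * A / eta = 0 ->
  B11 / B - (w2 / B) ^ 2 + 2 + (- 2 * A ^ 2 - 2 * P * A1) / eta
    - (- 2 * P * A / eta) ^ 2 <= 0 ->
  B2 / B + (- 2 * P * w - 2 * W ^ 2 * Y) / eta = 0 ->
  B22 / B - (B2 / B) ^ 2 + (- 2 * w ^ 2 - 2 * P * w2 - 2 * W ^ 2) / eta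
    - ((- 2 * P * w - 2 * W ^ 2 * Y) / eta) ^ 2 <= 0 ->
  B * eta <= c * (4 + 2 * W).
Proof.
intros HA HB HAB EA1 EB2 Eyy Hc HW Hw HX Heta He Gx1 Gx2 Gy1 Gy2.
assert (Hi : 0 < / eta) by now apply Rinv_0_lt_compat.
assert (F1 : A * (B2 / B) ^ 2 * B = (w1 * B) ^ 2).
{ transitivity ((A * B2) ^ 2 / (A * B)); [field; split; lra |].
  rewrite HAB. replace (A * B2) with (- (w1 * B)) by lra. field. }
set (f := (- 2 * P * w - 2 * W ^ 2 * Y) / eta) in *.
assert (F2 : A * f ^ 2 * B = (w1 * B) ^ 2).
{ rewrite <- F1. replace f with (- (B2 / B)) by lra. ring. }
assert (F3 : B * (B11 / B) * B + A * (B22 / B) * B = 2 * (w1 * B) ^ 2).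
{ rewrite <- Eyy. field. lra. }
assert (F4 : B * ((- 2 * A ^ 2 - 2 * P * A1) / eta) * B
   + A * ((- 2 * w ^ 2 - 2 * P * w2 - 2 * W ^ 2) / eta) * B
   = - (2 + 2 * w ^ 2 + 2 * W ^ 2) * / eta).
{ transitivity ((- 2 * (A * B) ^ 2 - 2 * (A * B) * (w ^ 2 + W ^ 2)
     - 2 * P * B * (A1 * B + A * w2)) * / eta); [field; lra |].
  rewrite HAB, EA1. ring. }
set (g := B * (- 2 * P * A / eta)).
assert (Hg : g = - 2 * P * / eta).
{ unfold g. transitivity (- 2 * P * (A * B) * / eta); [field; lra | rewrite HAB; ring]. }
assert (F5 : B * (w2 / B) = - (2 * X * B + g)).
{ unfold g. replace (w2 / B) with (- (2 * X) - - 2 * P * A / eta) by lra. ring. }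
assert (Sum : 2 * B ^ 2 - (2 * X * B + g) ^ 2 - g ^ 2
   - (2 + 2 * w ^ 2 + 2 * W ^ 2) * / eta <= 0).
{ apply (Rmult_le_compat_l (B * B)) in Gx2; [| nra].
  apply (Rmult_le_compat_l (A * B)) in Gy2; [| nra].
  replace ((2 * X * B + g) ^ 2) with ((B * (w2 / B)) ^ 2) by (rewrite F5; ring).
  unfold g. lra. }
assert (Hw2 : w ^ 2 <= W ^ 2) by (apply Rabs_le_between in Hw; clear - Hw; nra).
assert (HX2 : X ^ 2 <= 1 / 100) by (apply Rabs_le_between in HX; clear - HX; nra).
assert (S2 : 3 / 2 * B ^ 2 <= 3 * g ^ 2 + (2 + 4 * W ^ 2) * / eta).
{ assert (0 <= (2 * X * B - g) ^ 2) by apply pow2_ge_0.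
  assert (B ^ 2 * X ^ 2 <= B ^ 2 * (1 / 100)) by (apply Rmult_le_compat_l; [apply pow2_ge_0 | lra]).
  assert (w ^ 2 * / eta <= W ^ 2 * / eta) by (apply Rmult_le_compat_r; lra).
  assert (0 <= B ^ 2) by apply pow2_ge_0.
  lra. }
assert (HP : P ^ 2 <= c ^ 2 /\ eta <= c ^ 2).
{ assert (0 <= P ^ 2) by apply pow2_ge_0. assert (0 <= (W * Y) ^ 2) by apply pow2_ge_0. lra. }
assert (S3 : 3 / 2 * (B * eta) ^ 2 <= c ^ 2 * (14 + 4 * W ^ 2)).
{ apply (Rmult_le_compat_l (eta ^ 2)) in S2; [| apply pow2_ge_0].
  rewrite Hg in S2.
  replace (eta ^ 2 * (3 * (- 2 * P * / eta) ^ 2 + (2 + 4 * W ^ 2) * / eta))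
    with (12 * P ^ 2 + (2 + 4 * W ^ 2) * eta) in S2 by (field; lra).
  assert ((2 + 4 * W ^ 2) * eta <= (2 + 4 * W ^ 2) * c ^ 2)
    by (apply Rmult_le_compat_l; [assert (0 <= W ^ 2) by apply pow2_ge_0 |]; lra).
  lra. }
apply Rnot_lt_le. intros N.
assert (Q : (c * (4 + 2 * W)) ^ 2 <= (B * eta) ^ 2) 
  by (apply pow_incr; split; [apply Rmult_le_pos; lra | lra]).
assert (Hc2 : 0 < c ^ 2) by (apply pow_lt; lra).
assert (0 < c ^ 2 * W) by (apply Rmult_lt_0_compat; lra).
assert (0 < c ^ 2 * W ^ 2) by (apply Rmult_lt_0_compat; [lra | apply pow_lt; lra]).
lra.
Qed.

Lemma pure_derivative_bound D d (W c r x0 y0 : R) :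
  solution D d -> 0 < W -> 0 < c -> 0 < r <= 1 / 10 ->
  (forall x y, x0 - r <= x <= x0 + r -> y0 - c / W <= y <= y0 + c / W ->
     D x y /\ Rabs (d^[1,1] x y) <= W) ->
  2 * c <= d^[1,0] (x0 + r) y0 - d^[1,0] x0 y0 ->
  2 * c <= d^[1,0] x0 y0 - d^[1,0] (x0 - r) y0 ->
  d^[0,2] x0 y0 <= 3 * (4 + 2 * W) / c.
Proof.
intros S HW Hc Hr HD Hplus Hminus.
set (rho := c / W) in *.
assert (Hrho : 0 < rho) by (apply Rdiv_lt_0_compat; assumption).
assert (HWrho : W * rho = c) by (unfold rho; field; lra).
set (p0 := d^[1,0] x0 y0) in *.
set (eta := fun x y => c ^ 2 - (d^[1,0] x y - p0) ^ 2 - W ^ 2 * (y - y0) ^ 2).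
set (psi := fun x y => d^[0,2] x y * exp (1 * (x - x0) ^ 2) * eta x y).
destruct (rectangle_max psi (x0 - r) (x0 + r) (y0 - rho) (y0 + rho))
  as (x1 & y1 & Hx1 & Hy1 & Hmax); try lra.
{ intros x y Hx Hy. destruct (HD x y Hx Hy) as (HDxy & _).
  assert (C02 := sol_cont _ _ S 0 2 x y ltac:(lia) HDxy).
  assert (C10 := sol_cont _ _ S 1 0 x y ltac:(lia) HDxy).
  unfold psi, eta. cont2d. }
destruct (HD x1 y1 Hx1 Hy1) as (HD1 & Hw1).
assert (HB := sol_pos_yy _ _ _ _ S HD1).
assert (HB0 : 0 < d^[0,2] x0 y0) by (apply (sol_pos_yy D d x0 y0 S), HD; lra).
assert (Psi0 : psi x0 y0 = c ^ 2 * d^[0,2] x0 y0).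
{ unfold psi, eta, p0. replace (1 * (x0 - x0) ^ 2) with 0 by ring. rewrite exp_0. ring. }
assert (Heta : 0 < eta x1 y1).
{ apply Rnot_le_lt. intros N.
  assert (H : psi x0 y0 <= psi x1 y1) by (apply Hmax; lra).
  assert (psi x1 y1 <= 0).
  { unfold psi. assert (0 < d^[0,2] x1 y1 * exp (1 * (x1 - x0) ^ 2))
      by (apply Rmult_lt_0_compat; [exact HB | apply exp_pos]). nra. }
  assert (0 < c ^ 2 * d^[0,2] x0 y0) by (apply Rmult_lt_0_compat; nra). lra. }
(* On the boundary of the rectangle eta is nonpositive: the horizontal sides by
   the choice of rho, the vertical ones by the assumed increments of u_x. *)
assert (Hside : forall x, x0 - r <= x <= x0 + r -> forall y, y0 - rho <= y <= y0 + rho ->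
   Rabs (d^[1,0] x y - d^[1,0] x y0) <= c).
{ intros x Hx y Hy.
  destruct (MVT_gen (fun y => d^[1,0] x y) y0 y (fun y => d^[1,1] x y)) as (z & Hz & E).
  - intros z Hz. apply (sol_dy _ _ S); [lia |]. apply HD; [exact Hx |].
    unfold Rmin, Rmax in Hz; destruct (Rle_dec y0 y); lra.
  - intros z Hz. apply continuity_pt_filterlim, (ex_derive_continuous (fun y => d^[1,0] x y)).
    exists (d^[1,1] x z). apply (sol_dy _ _ S); [lia |]. apply HD; [exact Hx |].
    unfold Rmin, Rmax in Hz; destruct (Rle_dec y0 y); lra.
  - rewrite E, Rabs_mult, <- HWrho.
    apply Rmult_le_compat; try apply Rabs_pos; [| apply Rabs_le; lra].
    apply HD; [exact Hx |]. unfold Rmin, Rmax in Hz; destruct (Rle_dec y0 y); lra. }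
assert (HP : Rabs (d^[1,0] x1 y1 - p0) < c).
{ assert (0 <= (W * (y1 - y0)) ^ 2) by apply pow2_ge_0.
  assert ((d^[1,0] x1 y1 - p0) ^ 2 < c ^ 2) by (unfold eta in Heta; lra).
  apply Rabs_def1; nra. }
assert (Hx1' : x0 - r < x1 < x0 + r).
{ apply Rabs_def2 in HP.
  split; apply Rnot_le_lt; intros N.
  - replace x1 with (x0 - r) in HP by lra.
    assert (K := Hside (x0 - r) ltac:(lra) y1 Hy1). apply Rabs_le_between in K. lra.
  - replace x1 with (x0 + r) in HP by lra.
    assert (K := Hside (x0 + r) ltac:(lra) y1 Hy1). apply Rabs_le_between in K. lra. }
assert (HY : Rabs (y1 - y0) < rho).
{ assert (0 <= (d^[1,0] x1 y1 - p0) ^ 2) by apply pow2_ge_0.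
  assert (Q : W ^ 2 * (y1 - y0) ^ 2 < W ^ 2 * rho ^ 2)
    by (unfold eta in Heta; replace (W ^ 2 * rho ^ 2) with ((W * rho) ^ 2) by ring;
        rewrite HWrho; lra).
  apply Rmult_lt_reg_l in Q; [| nra]. apply Rabs_def1; nra. }
apply Rabs_def2 in HY.
assert (Hpx : forall t y, D t y ->
  is_derive (fun t => eta t y) t (- 2 * (d^[1,0] t y - p0) * d^[2,0] t y)).
{ intros t y Ht. unfold eta.
  assert (H := sol_dx _ _ S 1 0 t y ltac:(lia) Ht).
  auto_derive; [repeat split; eexists; exact H |].
  replace (Derive (fun x => d^[1,0] x y) t) with (d^[2,0] t y)
    by (symmetry; now apply is_derive_unique). ring. }
assert (Hpy : forall x t, D x t ->
  is_derive (fun t => eta x t) t (- 2 * (d^[1,0] x t - p0) * d^[1,1] x t - 2 * W ^ 2 * (t - y0))).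
{ intros x t Ht. unfold eta.
  assert (H := sol_dy _ _ S 1 0 x t ltac:(lia) Ht).
  auto_derive; [repeat split; eexists; exact H |].
  replace (Derive (fun z => d^[1,0] x z) t) with (d^[1,1] x t)
    by (symmetry; now apply is_derive_unique). ring. }
destruct (pure_barrier_slice 1 x0 x1 (fun t => d^[0,2] t y1) (fun t => eta t y1)
  (fun t => d^[1,2] t y1) (fun t => - 2 * (d^[1,0] t y1 - p0) * d^[2,0] t y1)
  (d^[2,2] x1 y1) (- 2 * d^[2,0] x1 y1 ^ 2 - 2 * (d^[1,0] x1 y1 - p0) * d^[3,0] x1 y1))
  as [Gx1 Gx2]; [exact HB | exact Heta | | | | |].
{ generalize (locally_x _ _ _ _ S HD1). apply filter_imp. intros t Ht.
  split; [apply (sol_dx _ _ S); [lia | exact Ht] | now apply Hpx]. }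
{ apply (sol_dx _ _ S); [lia | exact HD1]. }
{ assert (H := sol_dx _ _ S 1 0 x1 y1 ltac:(lia) HD1).
  assert (H' := sol_dx _ _ S 2 0 x1 y1 ltac:(lia) HD1).
  auto_derive; [repeat split; eexists; eassumption |].
  replace (Derive (fun x => d^[1,0] x y1) x1) with (d^[2,0] x1 y1)
    by (symmetry; now apply is_derive_unique).
  replace (Derive (fun x => d^[2,0] x y1) x1) with (d^[3,0] x1 y1)
    by (symmetry; now apply is_derive_unique). ring. }
{ generalize (locally_interior _ _ _ Hx1'). apply filter_imp. intros t Ht.
  apply (Hmax t y1); lra. }
destruct (pure_barrier_slice 0 y0 y1 (fun t => d^[0,2] x1 t) (fun t => eta x1 t)
  (fun t => d^[0,3] x1 t)
  (fun t => - 2 * (d^[1,0] x1 t - p0) * d^[1,1] x1 t - 2 * W ^ 2 * (t - y0))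
  (d^[0,4] x1 y1)
  (- 2 * d^[1,1] x1 y1 ^ 2 - 2 * (d^[1,0] x1 y1 - p0) * d^[1,2] x1 y1 - 2 * W ^ 2))
  as [Gy1 Gy2]; [exact HB | exact Heta | | | | |].
{ generalize (locally_y _ _ _ _ S HD1). apply filter_imp. intros t Ht.
  split; [apply (sol_dy _ _ S); [lia | exact Ht] | now apply Hpy]. }
{ apply (sol_dy _ _ S); [lia | exact HD1]. }
{ assert (H := sol_dy _ _ S 1 0 x1 y1 ltac:(lia) HD1).
  assert (H' := sol_dy _ _ S 1 1 x1 y1 ltac:(lia) HD1).
  auto_derive; [repeat split; eexists; eassumption |].
  replace (Derive (fun x => d^[1,0] x1 x) y1) with (d^[1,1] x1 y1)
    by (symmetry; now apply is_derive_unique).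
  replace (Derive (fun x => d^[1,1] x1 x) y1) with (d^[1,2] x1 y1)
    by (symmetry; now apply is_derive_unique). ring. }
{ generalize (locally_interior (y0 - rho) (y0 + rho) y1 ltac:(lra)). apply filter_imp.
  intros t Ht.
  assert (L : psi x1 t <= psi x1 y1) by (apply Hmax; lra).
  assert (Hexp := exp_pos (1 * (x1 - x0) ^ 2)).
  rewrite !Rmult_0_l, exp_0, !Rmult_1_r.
  apply (Rmult_le_reg_l _ _ _ Hexp). unfold psi in L. lra. }
assert (Key : d^[0,2] x1 y1 * eta x1 y1 <= c * (4 + 2 * W)).
{ apply (pure_barrier_algebra (d^[2,0] x1 y1) (d^[0,2] x1 y1) (d^[3,0] x1 y1)
    (d^[0,3] x1 y1) (d^[2,2] x1 y1) (d^[0,4] x1 y1) (d^[1,1] x1 y1) (d^[2,1] x1 y1)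
    (d^[1,2] x1 y1) (d^[1,0] x1 y1 - p0) (x1 - x0) (y1 - y0)); try assumption.
  - now apply (sol_pos _ _ S).
  - now apply (sol_eq _ _ S).
  - now apply (equation_x D d).
  - now apply (equation_y D d).
  - now apply (equation_yy D d).
  - apply Rabs_le; lra.
  - reflexivity.
  - lra.
  - lra.
  - lra.
  - lra. }
assert (H : psi x0 y0 <= psi x1 y1) by (apply Hmax; lra).
assert (U : exp (1 * (x1 - x0) ^ 2) <= 3).
{ apply Rle_trans with (exp 1); [apply Rlt_le, exp_increasing; clear - Hx1 Hr; nra | apply exp_le_3]. }
assert (psi x1 y1 <= c * (4 + 2 * W) * 3).
{ unfold psi. replace (d^[0,2] x1 y1 * exp (1 * (x1 - x0) ^ 2) * eta x1 y1)
    with (d^[0,2] x1 y1 * eta x1 y1 * exp (1 * (x1 - x0) ^ 2)) by ring.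
  apply Rmult_le_compat; try lra.
  - apply Rmult_le_pos; lra.
  - apply Rlt_le, exp_pos. }
apply (Rmult_le_reg_l (c ^ 2)); [apply pow_lt; lra |].
replace (c ^ 2 * (3 * (4 + 2 * W) / c)) with (c * (4 + 2 * W) * 3) by (field; lra). lra.
Qed.

(** * The interior estimate *)

Lemma convex_derivative_bound (f f1 f2 : R -> R) (x h K : R) :
  0 < h ->
  (forall t, x - h <= t <= x + h ->
     is_derive f t (f1 t) /\ is_derive f1 t (f2 t) /\ 0 <= f2 t /\ Rabs (f t) <= K) ->
  Rabs (f1 x) <= 2 * K / h.
Proof.
intros Hh H.
assert (Mono : forall a b, x - h <= a -> a <= b -> b <= x + h -> f1 a <= f1 b).
{ intros a b Ha Hab Hb.
  destruct (mean_value f1 f2 a b Hab) as (c & Hc & E); [intros t Ht; apply H; lra |].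
  assert (0 <= f2 c * (b - a)) by (apply Rmult_le_pos; [apply H |]; lra). lra. }
assert (B : forall t, x - h <= t <= x + h -> - K <= f t <= K)
  by (intros t Ht; apply Rabs_le_between, H, Ht).
assert (B0 := B x ltac:(lra)). assert (B1 := B (x - h) ltac:(lra)).
assert (B2 := B (x + h) ltac:(lra)).
destruct (mean_value f f1 x (x + h)) as (c & Hc & E); [lra | intros t Ht; apply H; lra |].
destruct (mean_value f f1 (x - h) x) as (c' & Hc' & E'); [lra | intros t Ht; apply H; lra |].
assert (M1 := Mono x c ltac:(lra) ltac:(lra) ltac:(lra)).
assert (M2 := Mono c' x ltac:(lra) ltac:(lra) ltac:(lra)).
replace (f1 c * (x + h - x)) with (f1 c * h) in E by ring.
replace (f1 c' * (x - (x - h))) with (f1 c' * h) in E' by ring.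
apply (Rmult_le_compat_r h) in M1; [| lra]. apply (Rmult_le_compat_r h) in M2; [| lra].
apply Rabs_le.
split; apply (Rmult_le_reg_r h); try exact Hh.
- replace (- (2 * K / h) * h) with (- (2 * K)) by (field; lra). lra.
- replace (2 * K / h * h) with (2 * K) by (field; lra). lra.
Qed.

Lemma gradient_bound D d (K : R) :
  solution D d -> (forall x y, x ^ 2 + y ^ 2 < 1 -> D x y /\ Rabs (d^[0,0] x y) <= K) ->
  forall x y, Rabs x <= 13 / 20 -> Rabs y <= 13 / 20 -> Rabs (d^[1,0] x y) <= 40 * K.
Proof.
intros S HD x y Hx Hy. apply Rabs_le_between in Hx. apply Rabs_le_between in Hy.
replace (40 * K) with (2 * K / (1 / 20)) by field.
apply (convex_derivative_bound (fun t => d^[0,0] t y) (fun t => d^[1,0] t y) (fun t => d^[2,0] t y));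
  [lra |].
intros t Ht. destruct (HD t y) as (HDt & Hu); [nra |].
split; [apply (sol_dx _ _ S); [lia | exact HDt] |].
split; [apply (sol_dx _ _ S); [lia | exact HDt] |].
split; [apply Rlt_le, (sol_pos _ _ S), HDt | exact Hu].
Qed.

Lemma interior_estimate (K : R) : 0 <= K ->
  exists C, 0 < C /\ forall D d, solution D d ->
    (forall x y, x ^ 2 + y ^ 2 < 1 -> D x y /\ Rabs (d^[0,0] x y) <= K) ->
    forall x y, Rabs x <= 1 / 2 -> Rabs y <= 1 / 2 ->
      Rabs (d^[1,0] x y) <= C /\ Rabs (d^[0,1] x y) <= C /\ Rabs (d^[1,1] x y) <= C /\
      Rabs (d^[2,0] x y) <= C /\ Rabs (d^[0,2] x y) <= C.
Proof.
intros HK.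
(* The estimates hold on squares of decreasing half-side: 13/20 for the gradient,
   3/5 for the mixed derivative, where the cutoff is at least 1/256, and 1/2 for
   the pure ones. *)
set (M := 1 + 40 * K). set (W := 256 * (6000 * M)). set (r := 1 / 20).
set (c := W * r * exp (- (4 * M * W / r))).
set (C2 := 3 * (4 + 2 * W) / c).
assert (HM : 1 <= M) by (unfold M; lra).
assert (HW : 0 < W) by (unfold W; lra).
assert (Hr : 0 < r) by (unfold r; lra).
assert (Hc : 0 < c) by (apply Rmult_lt_0_compat; [now apply Rmult_lt_0_compat | apply exp_pos]).
assert (HC2 : 0 < C2) by (apply Rdiv_lt_0_compat; lra).
assert (Grad : forall D d, solution D d ->
    (forall x y, x ^ 2 + y ^ 2 < 1 -> D x y /\ Rabs (d^[0,0] x y) <= K) ->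
    forall x y, Rabs x <= 13 / 20 -> Rabs y <= 13 / 20 ->
      D x y /\ Rabs (d^[1,0] x y) <= M /\ Rabs (d^[0,1] x y) <= M).
{ intros D d S HD x y Hx Hy.
  assert (H1 := gradient_bound D d K S HD x y Hx Hy).
  assert (H2 : Rabs (d^[0,1] x y) <= 40 * K).
  { apply (gradient_bound _ _ K (solution_swap _ _ S)); try assumption.
    intros a b Hab. apply HD. lra. }
  split; [| split; unfold M; lra].
  apply HD. apply Rabs_le_between in Hx. apply Rabs_le_between in Hy. nra. }
assert (Mixed : forall D d, solution D d ->
    (forall x y, x ^ 2 + y ^ 2 < 1 -> D x y /\ Rabs (d^[0,0] x y) <= K) ->
    forall x y, Rabs x <= 3 / 5 -> Rabs y <= 3 / 5 -> Rabs (d^[1,1] x y) <= W).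
{ intros D d S HD x y Hx Hy.
  assert (G := Grad D d S HD).
  assert (H1 := mixed_derivative_bound D d 1 M (13 / 20) S ltac:(lra) HM ltac:(lra) G
    x y ltac:(lra) ltac:(lra)).
  assert (H2 := mixed_derivative_bound D d (-1) M (13 / 20) S ltac:(lra) HM ltac:(lra) G
    x y ltac:(lra) ltac:(lra)).
  apply Rabs_le_between in Hx. apply Rabs_le_between in Hy.
  assert (Ex : 1 / 16 <= (13 / 20) ^ 2 - x ^ 2) by nra.
  assert (Ey : 1 / 16 <= (13 / 20) ^ 2 - y ^ 2) by nra.
  assert (E : 1 / 256 <= ((13 / 20) ^ 2 - x ^ 2) * ((13 / 20) ^ 2 - y ^ 2))
    by (replace (1 / 256) with (1 / 16 * (1 / 16)) by field; apply Rmult_le_compat; lra).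
  generalize dependent (((13 / 20) ^ 2 - x ^ 2) * ((13 / 20) ^ 2 - y ^ 2)).
  intros eta H1 H2 E.
  assert (L : forall z, eta * z <= 6000 * M -> z <= W).
  { intros z Hz. destruct (Rle_or_lt z 0) as [|P]; [lra |].
    assert (1 / 256 * z <= eta * z) by (apply Rmult_le_compat_r; lra).
    unfold W. lra. }
  apply L in H1. apply L in H2. apply Rabs_le; lra. }
assert (Pure : forall D d, solution D d ->
    (forall x y, x ^ 2 + y ^ 2 < 1 -> D x y /\ Rabs (d^[0,0] x y) <= K) ->
    forall x y, Rabs x <= 1 / 2 -> Rabs y <= 1 / 2 -> Rabs (d^[0,2] x y) <= C2).
{ intros D d S HD x y Hx Hy.
  apply Rabs_le_between in Hx. apply Rabs_le_between in Hy.
  assert (HW' : forall a b, x - r <= a <= x + r -> y - r <= b <= y + 2 * r ->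
     D a b /\ Rabs (d^[0,1] a b) <= M /\ Rabs (d^[1,1] a b) <= W).
  { unfold r. intros a b Ha Hb.
    assert (Ra : Rabs a <= 3 / 5) by (apply Rabs_le; lra).
    assert (Rb : Rabs b <= 3 / 5) by (apply Rabs_le; lra).
    destruct (Grad D d S HD a b) as (G1 & G2 & G3); try lra.
    split; [exact G1 | split; [exact G3 |]]. now apply (Mixed D d). }
  assert (HDxy : D x y) by (apply HW'; lra).
  rewrite Rabs_pos_eq; [| now apply Rlt_le, (sol_pos_yy D d)].
  assert (Hexp : exp (- (4 * M * W / r)) <= 1).
  { rewrite <- exp_0. apply Rlt_le, exp_increasing.
    assert (0 < 4 * M * W / r) by (apply Rdiv_lt_0_compat; nra). lra. }
  assert (Hrho : c / W <= r).
  { unfold c. replace (W * r * exp (- (4 * M * W / r)) / W)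
      with (r * exp (- (4 * M * W / r))) by (field; lra).
    nra. }
  assert (Two : 2 * c = 2 * W * r * exp (- (4 * M * W / r))) by (unfold c; ring).
  apply (pure_derivative_bound D d W c r x y S HW Hc); [unfold r; lra | | |].
  - intros a b Ha Hb. destruct (HW' a b Ha ltac:(lra)) as (G1 & _ & G3). now split.
  - rewrite Two. apply (slope_increment_lower_bound D d M W x r y S Hr HW).
    intros a b Ha Hb. apply HW'; lra.
  - rewrite Two.
    assert (L := slope_increment_lower_bound D d M W (x - r) r y S Hr HW).
    replace (x - r + r) with x in L by ring. apply L.
    intros a b Ha Hb. apply HW'; lra. }
exists (M + W + C2). split; [lra |].
intros D d S HD x y Hx Hy.
destruct (Grad D d S HD x y) as (_ & G1 & G2); try lra.
assert (G3 := Mixed D d S HD x y ltac:(lra) ltac:(lra)).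
assert (G4 := Pure D d S HD x y Hx Hy).
assert (G5 : Rabs (d^[2,0] x y) <= C2).
{ apply (Pure _ _ (solution_swap _ _ S)); try assumption.
  intros a b Hab. apply HD. lra. }
repeat split; lra.
Qed.

(** * Classical solutions in the unit disc *)

Lemma ball0_iff r x y : 0 < r -> ball0 r x y <-> x ^ 2 + y ^ 2 < r ^ 2.
Proof.
intros Hr. unfold ball0.
assert (0 <= x ^ 2 + y ^ 2) by (apply Rplus_le_le_0_compat; apply pow2_ge_0).
rewrite <- (sqrt_pow2 r) at 1 by lra. split; intros H1.
- now apply sqrt_lt_0_alt.
- now apply sqrt_lt_1_alt.
Qed.

Lemma ball0_open r x y : 0 < r -> ball0 r x y -> locally_2d (ball0 r) x y.
Proof.
intros Hr H. apply ball0_iff in H; [| exact Hr].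
assert (C : continuity_2d_pt (fun u v => u ^ 2 + v ^ 2) x y) by cont2d.
destruct (C (mkposreal (r ^ 2 - (x ^ 2 + y ^ 2)) ltac:(lra))) as [e He].
exists e. intros u v Hu Hv. apply ball0_iff; [exact Hr |].
specialize (He u v Hu Hv). simpl in He. apply Rabs_def2 in He. simpl. lra.
Qed.

Section Derivatives.

Variables (D : R -> R -> Prop).
Hypothesis D_open : forall x y, D x y -> locally_2d D x y.

Lemma class_pd1 n u : of_class_C (S n) D u -> of_class_C n D (pd1 u).
Proof. intros H x y Hxy. apply (H x y Hxy). Qed.

Lemma class_pd2 n u : of_class_C (S n) D u -> of_class_C n D (pd2 u).
Proof. intros H x y Hxy. apply (H x y Hxy). Qed.

Lemma class_derive_x n u x y : of_class_C (S n) D u -> D x y ->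
  is_derive (fun t => u t y) x (pd1 u x y).
Proof. intros H Hxy. apply Derive_correct, (H x y Hxy). Qed.

Lemma class_derive_y n u x y : of_class_C (S n) D u -> D x y ->
  is_derive (fun t => u x t) y (pd2 u x y).
Proof. intros H Hxy. apply Derive_correct, (H x y Hxy). Qed.

Lemma class_continuous n u x y : of_class_C n D u -> D x y -> continuity_2d_pt u x y.
Proof. intros H Hxy. destruct n; apply (H x y Hxy). Qed.

Lemma pd_commute n u x y : of_class_C (S (S n)) D u -> D x y ->
  pd2 (pd1 u) x y = pd1 (pd2 u) x y.
Proof.
intros H Hxy. symmetry.
assert (H1 := class_pd1 _ _ H). assert (H2 := class_pd2 _ _ H).
apply (Schwarz u x y).
- apply (locally_2d_impl D); [| now apply D_open].
  apply locally_2d_forall. intros a b Hab.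
  split; [| split; [| split]].
  + exists (pd1 u a b). now apply (class_derive_x (S n)).
  + exists (pd2 u a b). now apply (class_derive_y (S n)).
  + exists (pd1 (pd2 u) a b). now apply (class_derive_x n (pd2 u)).
  + exists (pd2 (pd1 u) a b). now apply (class_derive_y n (pd1 u)).
- now apply (class_continuous n (pd1 (pd2 u))); [apply class_pd1 |].
- now apply (class_continuous n (pd2 (pd1 u))); [apply class_pd2 |].
Qed.

Lemma pd1_ext u v x y : (forall a b, D a b -> u a b = v a b) -> D x y ->
  pd1 u x y = pd1 v x y.
Proof.
intros H Hxy. apply Derive_ext_loc.
generalize (locally_2d_1d_const_y D x y (D_open x y Hxy)).
apply filter_imp. intros t Ht. now apply H.
Qed.

Lemma class_pred n u : of_class_C (S n) D u -> of_class_C n D u.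
Proof.
revert u. induction n as [| n IH]; intros u H x y Hxy.
- split; [| exact I]. now apply (H x y).
- split; [apply (H x y Hxy) |]. split; [apply (H x y Hxy) |].
  split; [apply (H x y Hxy) |]. split.
  + now apply (IH (pd1 u)); [apply class_pd1 |].
  + now apply (IH (pd2 u)); [apply class_pd2 |].
Qed.

Lemma class_le m n u : (m <= n)%nat -> of_class_C n D u -> of_class_C m D u.
Proof. intros L. induction L as [| n L IH]; intros H; [exact H | now apply IH, class_pred]. Qed.

(** The partial derivative of order [i] in the first and [j] in the second variable,
    differentiating in the second variable first. *)
Definition partial (u : R -> R -> R) (i j : nat) : R -> R -> R :=
  Nat.iter i pd1 (Nat.iter j pd2 u).

Lemma class_partial u n i j : of_class_C (i + j + n) D u -> of_class_C n D (partial u i j).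
Proof.
intros H. unfold partial. revert n H. induction i as [| i IH]; intros n H.
- revert n H. induction j as [| j IH]; intros n H; [exact H |].
  apply class_pd2, IH. replace (0 + j + S n)%nat with (0 + S j + n)%nat by lia. exact H.
- apply class_pd1, IH. replace (i + j + S n)%nat with (S i + j + n)%nat by lia. exact H.
Qed.

Lemma pd2_partial u i j x y : of_class_C (S (i + j)) D u -> D x y ->
  pd2 (partial u i j) x y = partial u i (S j) x y.
Proof.
revert x y. induction i as [| i IH]; intros x y H Hxy; [reflexivity |].
change (partial u (S i) j) with (pd1 (partial u i j)).
change (partial u (S i) (S j)) with (pd1 (partial u i (S j))).
rewrite (pd_commute 0); [| | exact Hxy].
- apply pd1_ext; [| exact Hxy]. intros a b Hab. apply IH; [| exact Hab].
  now apply class_pred.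
- apply class_partial. now replace (i + j + 2)%nat with (S (S i + j)) by lia.
Qed.

Lemma coordinate_convex_pd11_nonneg u x y :
  of_class_C 2 D u -> coordinate_convex D u -> D x y -> 0 <= pd1 (pd1 u) x y.
Proof.
intros H (_ & Hc & _) Hxy.
destruct (locally_2d_1d_const_y D x y (D_open x y Hxy)) as [e He].
assert (He' : forall h, - e < h < e -> D (x + h) y)
  by (intros h Hh; apply He; apply Rabs_def1; unfold minus, plus, opp; simpl; lra).
assert (Hpos := cond_pos e).
(* The symmetric second difference of u is minimal at h = 0. *)
destruct (second_derivative_test (fun h => - u (x + h) y - u (x - h) y)
  (fun h => - pd1 u (x + h) y + pd1 u (x - h) y) (- 2 * pd1 (pd1 u) x y) 0) as [_ L].
- generalize (locally_interior (- e) e 0 ltac:(lra)). apply filter_imp. intros h Hh.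
  assert (H1 := class_derive_x 1 u (x + h) y H (He' h Hh)).
  assert (H2 := class_derive_x 1 u (x - h) y H (He' (- h) ltac:(lra))).
  auto_derive; [split; [eexists; exact H1 | split; [eexists; exact H2 | exact I]] |].
  replace (Derive (fun z => u z y) (x + h)) with (pd1 u (x + h) y)
    by (symmetry; now apply is_derive_unique).
  replace (Derive (fun z => u z y) (x + - h)) with (pd1 u (x - h) y)
    by (symmetry; now apply is_derive_unique). ring.
- assert (H1 := class_derive_x 0 (pd1 u) x y (class_pd1 _ _ H) Hxy).
  assert (H1' : is_derive (fun z => pd1 u z y) (x + 0) (pd1 (pd1 u) x y))
    by now rewrite Rplus_0_r.
  assert (H2' : is_derive (fun z => pd1 u z y) (x + - 0) (pd1 (pd1 u) x y))
    by now rewrite Ropp_0, Rplus_0_r.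
  auto_derive; [split; [eexists; exact H1' | split; [eexists; exact H2' | exact I]] |].
  replace (Derive (fun z => pd1 u z y) (x + 0)) with (pd1 (pd1 u) x y)
    by (symmetry; now apply is_derive_unique).
  replace (Derive (fun z => pd1 u z y) (x + - 0)) with (pd1 (pd1 u) x y)
    by (symmetry; now apply is_derive_unique). ring.
- generalize (locally_interior (- e) e 0 ltac:(lra)). apply filter_imp. intros h Hh.
  assert (L := Hc (x - h) (x + h) y).
  assert (Hseg : forall t, 0 <= t <= 1 -> D (segment (x - h) (x + h) t) y).
  { intros t Ht. unfold segment.
    replace ((1 - t) * (x - h) + t * (x + h)) with (x + (2 * t - 1) * h) by ring.
    apply He', and_comm, (Rabs_def2 _ (pos e)). rewrite Rabs_mult.
    assert (H1 : Rabs (2 * t - 1) <= 1) by (apply Rabs_le; lra).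
    assert (H2 : Rabs h < e) by (apply Rabs_def1; lra).
    assert (H3 := Rabs_pos h). nra. }
  specialize (L Hseg (1 / 2) ltac:(lra)). unfold segment in L.
  replace ((1 - 1 / 2) * (x - h) + 1 / 2 * (x + h)) with x in L by field.
  rewrite Rplus_0_r, Rminus_0_r. lra.
- lra.
Qed.

Lemma solution_of_class u :
  of_class_C 4 D u -> coordinate_convex D u ->
  (forall x y, D x y -> sqrt (pd1 (pd1 u) x y * pd2 (pd2 u) x y) = 1) ->
  solution D (partial u).
Proof.
intros H Hc He.
assert (Hcl : forall i j n, (i + j + n <= 4)%nat -> of_class_C n D (partial u i j))
  by (intros i j n L; apply class_partial; now apply (class_le _ 4)).
assert (Heq : forall x y, D x y -> partial u 2 0 x y * partial u 0 2 x y = 1).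
{ intros x y Hxy. specialize (He x y Hxy).
  change (partial u 2 0) with (pd1 (pd1 u)). change (partial u 0 2) with (pd2 (pd2 u)).
  destruct (Rle_or_lt 0 (pd1 (pd1 u) x y * pd2 (pd2 u) x y)) as [P | N].
  - rewrite <- (sqrt_sqrt _ P), He. ring.
  - rewrite sqrt_neg_0 in He; lra. }
split.
- exact D_open.
- intros i j x y L Hxy. apply (class_derive_x 0 (partial u i j)); [apply Hcl; lia | exact Hxy].
- intros i j x y L Hxy. rewrite <- pd2_partial; [| now apply (class_le _ 4); [lia |] | exact Hxy].
  apply (class_derive_y 0 (partial u i j)); [apply Hcl; lia | exact Hxy].
- intros i j x y L Hxy. apply (class_continuous 0); [apply Hcl; lia | exact Hxy].
- exact Heq.
- intros x y Hxy. specialize (Heq x y Hxy).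
  assert (P : 0 <= partial u 2 0 x y)
    by (apply (coordinate_convex_pd11_nonneg u); [apply (class_le 2 4); [lia | exact H] | exact Hc | exact Hxy]).
  destruct P as [P | P]; [exact P | rewrite <- P in Heq; lra].
Qed.

End Derivatives.

Lemma sup_on_le Om f (K : R) :
  (forall x y, Om x y -> f x y <= K) -> Rbar_le (sup_on Om f) (Finite K).
Proof.
intros H. unfold sup_on.
apply (proj2 (Lub_Rbar_correct (fun z => exists x y, Om x y /\ z = f x y))).
intros z (x & y & Hxy & ->). now apply H.
Qed.

Lemma sqrt_sum_squares_le a b : sqrt (a ^ 2 + b ^ 2) <= Rabs a + Rabs b.
Proof.
assert (Ha := Rabs_pos a). assert (Hb := Rabs_pos b).
rewrite <- (sqrt_pow2 (Rabs a + Rabs b)) by lra.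
apply sqrt_le_1_alt. rewrite <- (pow2_abs a), <- (pow2_abs b). nra.
Qed.

Lemma C2_norm_bound (K : R) : 0 <= K ->
  exists C, 0 < C /\ forall u,
    of_class_C 4 (ball0 1) u -> coordinate_convex (ball0 1) u ->
    (forall x y, ball0 1 x y -> sqrt (pd1 (pd1 u) x y * pd2 (pd2 u) x y) = 1) ->
    (forall x y, ball0 1 x y -> Rabs (u x y) <= K) ->
    Rbar_lt (C2_norm (ball0 (1 / 2)) u) (Finite C).
Proof.
intros HK. destruct (interior_estimate K HK) as (C & HC & Est).
exists (K + 2 * C + 2 * C + 1). split; [lra |]. intros u Hu Hc He HuK.
assert (HO : forall x y, ball0 1 x y -> locally_2d (ball0 1) x y)
  by (intros x y; apply ball0_open; lra).
assert (S := solution_of_class (ball0 1) HO u Hu Hc He).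
assert (HD : forall x y, x ^ 2 + y ^ 2 < 1 -> ball0 1 x y /\ Rabs (partial u 0 0 x y) <= K).
{ intros x y Hxy. assert (B : ball0 1 x y) by (apply ball0_iff; lra).
  split; [exact B | now apply HuK]. }
assert (Sub : forall x y, ball0 (1 / 2) x y ->
   ball0 1 x y /\ Rabs x <= 1 / 2 /\ Rabs y <= 1 / 2).
{ intros x y B. apply ball0_iff in B; [| lra].
  assert (Hx := pow2_ge_0 x). assert (Hy := pow2_ge_0 y).
  split; [apply ball0_iff; lra |].
  split; apply Rabs_le; nra. }
assert (B := fun x y H => Est _ _ S HD x y (proj1 (proj2 (Sub x y H))) (proj2 (proj2 (Sub x y H)))).
apply Rbar_le_lt_trans with (Finite (K + 2 * C + 2 * C)); [| simpl; lra].
change (Finite (K + 2 * C + 2 * C))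
  with (Rbar_plus (Rbar_plus (Finite K) (Finite (2 * C))) (Finite (2 * C))).
unfold C2_norm. repeat apply Rbar_plus_le_compat; apply sup_on_le; intros x y Hxy.
- now apply HuK, Sub.
- destruct (B x y Hxy) as (B1 & B2 & _).
  change (partial u 1 0) with (pd1 u) in B1. change (partial u 0 1) with (pd2 u) in B2.
  unfold grad_norm. eapply Rle_trans; [apply sqrt_sum_squares_le | lra].
- destruct (B x y Hxy) as (_ & _ & B3 & B4 & B5).
  change (partial u 1 1) with (pd1 (pd2 u)) in B3.
  change (partial u 2 0) with (pd1 (pd1 u)) in B4.
  change (partial u 0 2) with (pd2 (pd2 u)) in B5.
  unfold hess_norm.
  rewrite (pd_commute (ball0 1) HO 2 u x y Hu) by now apply Sub.
  rewrite <- (sqrt_pow2 (2 * C)) by lra. apply sqrt_le_1_alt.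
  assert (Q : forall z, Rabs z <= C -> z ^ 2 <= C ^ 2)
    by (intros z Hz; rewrite <- pow2_abs; apply pow_incr; split; [apply Rabs_pos | exact Hz]).
  apply Q in B3. apply Q in B4. apply Q in B5. lra.
Qed.

(** * Pointwise values and the essential supremum *)

Module EssentialSupremum.

From mathcomp Require Import all_boot all_order all_algebra.
From mathcomp Require Import all_classical all_reals all_analysis.
From mathcomp Require Import ess_sup_inf hoelder Rstruct.
Import Order.TTheory GRing.Theory Num.Theory.
Local Open Scope classical_set_scope.
Local Open Scope ring_scope.

Definition closed_square (x y e : R) : set (R * R) :=
  [set` `[x - e, x + e]] `*` [set` `[y - e, y + e]].

Lemma lebesgue_measure2_square (x y e : R) : 0 < e ->
  (0 < lebesgue_measure2 (closed_square x y e))%E.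
Proof.
move=> e0.
have h (z : R) : z - e < z + e by rewrite ltrD2l (lt_trans _ e0) // oppr_lt0.
have mE (z : R) : lebesgue_measure [set` `[z - e, z + e]] = ((z + e) - (z - e))%:E.
  by rewrite lebesgue_measure_itv /= lte_fin h EFinN -EFinD.
rewrite /closed_square /lebesgue_measure2 product_measure1E //.
rewrite [X in (_ < X)%E](_ : _ = (((x + e) - (x - e)) * ((y + e) - (y - e)))%:E).
  by rewrite lte_fin mulr_gt0 // subr_gt0; exact: h.
by rewrite EFinM; congr (_ * _)%E; exact: mE.
Qed.

Lemma ess_sup_lebesgue_ge (f : R * R -> \bar R) (x y e : R) (c : \bar R) : 0 < e ->
  (forall a b, `|a - x| <= e -> `|b - y| <= e -> (c < f (a, b))%E) ->
  (c < ess_sup lebesgue_measure2 f)%E.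
Proof.
move=> e0 hf; rewrite ltNge; apply/negP => /ess_supP.
move=> [N [mN N0 sub]].
have := lebesgue_measure2_square x y e e0.
have -> : lebesgue_measure2 (closed_square x y e) = 0%E.
  apply: (subset_measure0 _ mN _ N0).
    by apply: measurableX; exact: measurable_itv.
  move=> [a b] [] /=; rewrite !in_itv /= => ha hb.
  apply: sub => /=; apply/negP; rewrite -ltNge.
  by apply: hf; rewrite ler_distl.
by rewrite ltxx.
Qed.

(** The upper bound [M] only serves to make the norm finite. *)
Lemma lt_Linf_norm (Om : R -> R -> Prop) (u : R -> R -> R) (x y e c M : R) :
  0 < e ->
  (forall a b, Om a b -> `|u a b| <= M) ->
  (forall a b, `|a - x| <= e -> `|b - y| <= e -> Om a b /\ c < `|u a b|) ->
  c < Linf_norm Om u.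
Proof.
move=> e0 hM hc. rewrite /Linf_norm.
set f := (X in Lnorm _ _ X).
have mpos : (0 < lebesgue_measure2 setT)%E.
  apply: (lt_le_trans (lebesgue_measure2_square x y e e0)).
  apply: le_measure; rewrite ?inE //.
    by apply: measurableX; exact: measurable_itv.
have lo : (c%:E < ess_sup lebesgue_measure2 (abse \o f))%E.
  apply: (ess_sup_lebesgue_ge _ x y e _ e0) => a b ha hb.
  have [hO hu] := hc a b ha hb.
  by rewrite /f /= patchT ?inE //= lte_fin.
have up : (ess_sup lebesgue_measure2 (abse \o f) <= (Num.max 0 M)%:E)%E.
  apply/ess_supP. apply: nearW => -[a b]. rewrite /f /= /patch.
  case: ifPn => /=; rewrite lee_fin le_max ?normr0 ?lexx //.
  by rewrite inE /= => /hM ->; rewrite orbT.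
rewrite unlock mpos.
by move: lo up; case: (ess_sup _ _) => [r||] //=; rewrite lte_fin.
Qed.

Lemma Rabs_le_Linf_norm (Om : R -> R -> Prop) (u : R -> R -> R) (x y : R) :
  (forall a b, Om a b -> locally_2d Om a b) ->
  (forall a b, Om a b -> continuity_2d_pt u a b) ->
  bounded_on Om u -> Om x y -> Rle (Rabs (u x y)) (Linf_norm Om u).
Proof.
move=> hO hu [M hM] hxy.
case: (Rle_or_lt (Rabs (u x y)) (Linf_norm Om u)) => // hlt; exfalso.
have he : Rlt 0 (Rabs (u x y) - Linf_norm Om u)%coqR by exact: Rlt_Rminus.
have [d1 h1] := hO x y hxy.
have [d2 h2] := hu x y hxy (mkposreal _ he).
pose e := (Rmin d1 d2 / 2)%coqR.
have dpos : Rlt 0 (Rmin d1 d2) by apply: Rmin_pos; exact: cond_pos.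
have e0 : Rlt 0 e by rewrite /e; lra.
have le1 : Rlt e d1 by apply: (Rlt_le_trans _ (Rmin d1 d2)); [rewrite /e; lra | exact: Rmin_l].
have le2 : Rlt e d2 by apply: (Rlt_le_trans _ (Rmin d1 d2)); [rewrite /e; lra | exact: Rmin_r].
apply: (Rlt_irrefl (Linf_norm Om u)).
apply/RltP; apply: (lt_Linf_norm Om u x y e _ M).
- exact/RltP.
- by move=> a b hab; rewrite -RabsE; apply/RleP; exact: hM.
- move=> a b ha hb.
  have ha' : Rle (Rabs (a - x)) e by apply/RleP; rewrite RabsE.
  have hb' : Rle (Rabs (b - y)) e by apply/RleP; rewrite RabsE.
  split; first by apply: h1; apply: Rle_lt_trans; eassumption.
  have /= hd := h2 a b (Rle_lt_trans _ _ _ ha' le2) (Rle_lt_trans _ _ _ hb' le2).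
  rewrite -RabsE; apply/RltP.
  have h3 := Rabs_triang_inv (u x y) (u a b).
  rewrite Rabs_minus_sym in h3. lra.
Qed.

End EssentialSupremum.

(** * The estimate in terms of the norm *)

Theorem theorem1p1 :
  exists C : R -> R,
    (forall s : R, 0 <= s -> 0 < C s) /\
    forall u : R -> R -> R,
      of_class_C 4 (ball0 1) u ->
      bounded_on (ball0 1) u ->
      coordinate_convex (ball0 1) u ->
      (forall x y : R, ball0 1 x y ->
         sqrt (pd1 (pd1 u) x y * pd2 (pd2 u) x y) = 1) ->
      Rbar_lt (C2_norm (ball0 (1 / 2)) u)
              (Finite (C (Linf_norm (ball0 1) u))).
Proof.
assert (H : forall s, exists C, 0 < C /\ forall u,
    of_class_C 4 (ball0 1) u -> coordinate_convex (ball0 1) u ->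
    (forall x y, ball0 1 x y -> sqrt (pd1 (pd1 u) x y * pd2 (pd2 u) x y) = 1) ->
    (forall x y, ball0 1 x y -> Rabs (u x y) <= Rabs s) ->
    Rbar_lt (C2_norm (ball0 (1 / 2)) u) (Finite C))
  by (intros s; apply C2_norm_bound, Rabs_pos).
exists (fun s => proj1_sig (constructive_indefinite_description _ (H s))).
split.
- intros s _. apply (proj2_sig (constructive_indefinite_description _ (H s))).
- intros u Hu Hb Hc He.
  apply (proj2 (proj2_sig (constructive_indefinite_description _ (H _)))); try assumption.
  intros x y Hxy.
  apply Rle_trans with (2 := Rle_abs _).
  apply EssentialSupremum.Rabs_le_Linf_norm; try assumption.
  + intros a b. apply ball0_open, Rlt_0_1.
  + intros a b. now apply class_continuous with (n := 4%nat).
Qed.
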